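(* Let $K$ be a finite field of characteristic $p$ and order $q=p^n$, and let $s$ be a positive integer with $\gcd(s,q-1)=1$. For $u\in K$ put $W_u=\sum_{x\in K}\psi(x^s-ux)$, and let $\mathcal{W}_{K,s}=\{W_u : u\in K^\times\}$ (a set of distinct values). If $|\mathcal{W}_{K,s}|=4$, then $\mathcal{W}_{K,s}\subseteq\mathbb{Z}$, unless $K=\mathbb{F}_5$ and $s\equiv 3\pmod 4$, in which case $\mathcal{W}_{K,s}=\{(5+\sqrt5)/2,\,(5-\sqrt5)/2,\,\sqrt5,\,-\sqrt5\}$.
   Context: $\zeta=\exp(2\pi i/p)$, $\mathrm{Tr}\colon K\to\mathbb{F}_p$ is the absolute trace $\mathrm{Tr}(x)=x+x^p+\cdots+x^{q/p}$, and $\psi(x)=\zeta^{\mathrm{Tr}(x)}$ is the canonical additive character of $K$. *)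

(* Defs.v *)
From mathcomp Require Import all_boot all_order all_algebra all_field.
Set Implicit Arguments. Unset Strict Implicit. Unset Printing Implicit Defensive.
Import Order.TTheory GRing.Theory Num.Theory.
Local Open Scope ring_scope.

(* zeta_p = exp(2 pi i / p) in algC: p.-root (-1) is the p-th root of -1 of
   minimal nonnegative argument, i.e. exp(i pi / p). *)
Definition zeta (p : nat) : algC := (p.-root (-1)) ^+ 2.

(* absolute trace K -> F_p (viewed inside K), where #|K| = p ^ n *)
Definition absTr (K : finFieldType) (p n : nat) (x : K) : K :=
  \sum_(i < n) x ^+ (p ^ i).

Definition trNat (K : finFieldType) (p n : nat) (x : K) : nat :=
  odflt 0%N (omap (@nat_of_ord p) [pick k : 'I_p | (k : nat)%:R == absTr p n x]).

Definition psi (K : finFieldType) (p n : nat) (x : K) : algC :=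
  zeta p ^+ trNat p n x.

Definition Wval (K : finFieldType) (p n s : nat) (u : K) : algC :=
  \sum_(x : K) psi p n (x ^+ s - u * x).

Definition Wset (K : finFieldType) (p n s : nat) : seq algC :=
  undup [seq Wval p n s u | u <- enum K & u != 0].

(* Main.v *)
(** Let [W u] denote the Weil sums, let [g] be a primitive root modulo [p] and
    let [sg] be the automorphism of [algC] raising [p]-th roots of unity to the
    power [g].  Then [sg (W u) = W (h * u)] for a constant [h] in the prime
    field, and the four values are all integers unless [sg] permutes them
    nontrivially; each cycle type is refuted separately.

    If all four values are conjugate, then summing [W] over a coset of [<h>]
    gives a constant [T] with [(q - 1) T = 4 q], so [q = 5].

    For the cycle types 3+1 and 2+2 the traces [R u = \sum_i W (h^i u)] take two
    integer values.  Since [W] and its translates [u |-> W (h^i u)] are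
    orthogonal, [\sum R = m q] and [\sum R^2 = m q^2], and [p]-adic valuations
    force [R] to be [q] on one coset of [<h>] and [0] elsewhere.  In type 3+1 the
    vanishing of [\sum_u W u * W (u + d)] for [d != 0] is then violated.  In type
    2+2, [W] is [+B] or [-B] off [0], [u0], [-u0] and sums to [0] over any line
    parallel to [u0] that avoids these points, which is impossible as such a line
    has an odd number of points; so [q = p], where a size estimate gives [q <= 6].

    For the cycle type 2+1+1 one has [h = -1], and the values [a], [b] (swapped)
    and [C], [E] (integers) satisfy two quadratic relations between [W u] and
    [W (- u)].  Their Fourier transforms relate linearly, for every [c], the
    number [fsum c] of [t] with [t^s + (1 - t)^s = c] and the number [fdif c] of
    [t] with [t^s - (1 - t)^s = c].  As [fsum c] is even for [c] other than [1],
    [-1] it vanishes somewhere, which gives [C * E = 0]; then the fourth moment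
    determines all the parameters, and they turn out to be inconsistent. *)

Require Import Defs.
From mathcomp Require Import all_boot all_order all_algebra all_field.
From mathcomp Require Import cyclic.
From mathcomp Require Import zify ring.
Import Order.TTheory GRing.Theory Num.Theory.
Local Open Scope ring_scope.
Set Implicit Arguments. Unset Strict Implicit. Unset Printing Implicit Defensive.

(** * Integer arithmetic *)

Lemma Euclid_dvdzM (p : nat) (x y : int) :
  prime p -> (p%:Z %| x * y)%Z = (p%:Z %| x)%Z || (p%:Z %| y)%Z.
Proof. by move=> p_pr; rewrite !dvdzE abszM Euclid_dvdM. Qed.

Lemma int_ppart (p : nat) (z : int) : prime p -> z != 0 ->
  exists (a : nat) (z' : int), z = p%:Z ^+ a * z' /\ ~~ (p%:Z %| z')%Z.
Proof.
move=> p_pr z0; have [|m pm Dz] := @pfactor_coprime p `|z|%N p_pr; first by rewrite absz_gt0.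
exists (logn p `|z|), (sgz z * m%:Z); split.
  by rewrite {1}[z]intEsg; move: Dz; set a := logn _ _ => ->; rewrite PoszM; lia.
rewrite Euclid_dvdzM // !dvdzE negb_or -(prime_coprime m) // pm andbT.
by case: sgzP z0 => //= *; rewrite dvdn1 neq_ltn prime_gt1 ?orbT.
Qed.

(** If neither divisibility holds, write [P = p^a P'] and [Q = p^b Q'] with [P'], [Q'] prime to [p]
    and, by symmetry, [a <= b < n]. Divided by [p^(a+b)], the relation has a left side prime to [p]
    and a factor [p^(n-b)] on the right. *)
Lemma two_value_dvd (p n m : nat) (P Q : int) : prime p -> (0 < n)%N ->
  P * Q * (p%:Z ^+ n - 1) = m%:Z * p%:Z ^+ n * (P + Q - p%:Z ^+ n) ->
  (p%:Z ^+ n %| P)%Z || (p%:Z ^+ n %| Q)%Z.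
Proof.
move=> p_pr n_gt0 eqPQ.
have [->|P0] := eqVneq P 0; first by rewrite dvdz0.
have [->|Q0] := eqVneq Q 0; first by rewrite dvdz0 orbT.
have [a [P' [DP pP]]] := int_ppart p_pr P0.
have [b [Q' [DQ pQ]]] := int_ppart p_pr Q0.
have [le_na|lt_an] := leqP n a.
  by rewrite DP -(subnKC le_na) exprD -mulrA dvdz_mulr.
have [le_nb|lt_bn] := leqP n b.
  by rewrite DQ -(subnKC le_nb) exprD -mulrA dvdz_mulr ?orbT.
wlog le_ab : a b P Q P' Q' {P0 Q0} eqPQ DP DQ pP pQ lt_an lt_bn / (a <= b)%N.
  move=> wl; case/orP: (leq_total a b) => ?; first exact: (wl a b P Q P' Q').
  by rewrite orbC (wl b a Q P Q' P') // [Q * P]mulrC eqPQ; ring.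
have p_neq0 : p%:Z != 0 by rewrite eqz_nat -lt0n prime_gt0.
pose X : int := P' + p%:Z ^+ (b - a) * Q' - p%:Z ^+ (n - a).
have eq1 : P' * Q' * (p%:Z ^+ n - 1) = p%:Z ^+ (n - b) * (m%:Z * X).
  apply: (mulfI (expf_neq0 (a + b) p_neq0)).
  transitivity (P * Q * (p%:Z ^+ n - 1)); first by rewrite DP DQ exprD; ring.
  have split_pow i j : (i <= j)%N -> p%:Z ^+ j = p%:Z ^+ i * p%:Z ^+ (j - i).
    by move=> le_ij; rewrite -exprD subnKC.
  rewrite eqPQ DP DQ exprD /X {1}(split_pow b n) ?(ltnW lt_bn) //.
  by rewrite (split_pow a n) ?(ltnW lt_an) // (split_pow a b) //; ring.
have: (p%:Z %| P' * Q' * (p%:Z ^+ n - 1))%Z.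
  by rewrite eq1 dvdz_mulr // -[X in (X %| _)%Z]expr1 dvdz_exp2l // subn_gt0.
rewrite !Euclid_dvdzM // (negPf pP) (negPf pQ) /=.
by rewrite rpredBl ?dvdz_exp // dvdz1 => /eqP p1; move: p_pr; rewrite -[p]/`|p%:Z|%N p1.
Qed.

Lemma small_multiple (k q : int) : 0 < q -> (k * q) ^+ 2 <= q ^+ 2 ->
  k = 0 \/ k = 1 \/ k = -1.
Proof.
move=> q0; rewrite -[leRHS]mul1r exprMn ler_pM2r ?exprn_gt0 //.
rewrite expr2 => k2; have : -1 <= k <= 1 by clear -k2; nia.
lia.
Qed.

(** By [two_value_dvd] and symmetry [Q = k q] with [q = p^n], and the size bound gives [|k| <= 1].
    The cases [k = 0] and [k = 1] are the two alternatives; [k = -1] gives [P (q - 1 + m) = 2 m q],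
    which is impossible. *)
Lemma two_value_arith (p n m : nat) (P Q : int) : prime p -> (4 < p)%N ->
  (0 < n)%N -> (1 < m < 4)%N -> (m.+1 < p ^ n)%N ->
  P * Q * (p%:Z ^+ n - 1) = m%:Z * p%:Z ^+ n * (P + Q - p%:Z ^+ n) ->
  P ^+ 2 <= (p%:Z ^+ n) ^+ 2 -> Q ^+ 2 <= (p%:Z ^+ n) ^+ 2 ->
  (P = 0 /\ Q = p%:Z ^+ n) \/ (P = p%:Z ^+ n /\ Q = 0).
Proof.
move=> p_pr p_gt4 n_gt0 m14 ltmq eqPQ leP leQ.
wlog dvQ : P Q eqPQ leP leQ / (p%:Z ^+ n %| Q)%Z.
  move=> wl; case/orP: (two_value_dvd p_pr n_gt0 eqPQ) => dv; last exact: wl.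
  suff: Q = 0 /\ P = p%:Z ^+ n \/ Q = p%:Z ^+ n /\ P = 0.
    by case=> -[-> ->]; [right | left].
  apply: wl leQ leP dv.
  by rewrite [Q * P]mulrC eqPQ; ring.
set q := p%:Z ^+ n in eqPQ leP leQ dvQ *.
have q_gt : m%:Z + 1 < q by rewrite /q; lia.
have [k DQ] := dvdzP dvQ.
have q_gt0 : 0 < q by lia.
have [k0|[k1|k1]] : k = 0 \/ k = 1 \/ k = -1.
  by apply: (small_multiple q_gt0); rewrite -DQ.
- right; have Q0 : Q = 0 by rewrite DQ k0 mul0r.
  split=> //; move: eqPQ; rewrite Q0 mulr0 mul0r addr0 => /esym/eqP.
  by rewrite mulf_eq0 subr_eq0 => /orP[|/eqP //]; rewrite mulf_eq0; lia.
- left; have Qq : Q = q by rewrite DQ k1 mul1r.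
  split=> //; move: eqPQ; rewrite Qq => eqPq.
  have: P * q * (q - 1 - m%:Z) = 0 by rewrite !mulrBr mulr1; lia.
  move/eqP; rewrite !mulf_eq0 => /orP[/orP[/eqP //|]|]; lia.
have Qq : Q = - q by rewrite DQ k1; lia.
have eq1 : P * (q - 1 + m%:Z) = q * (2 * m%:Z).
  apply: (@mulfI _ q); first by lia.
  by move: eqPQ; rewrite Qq; lia.
(* Modulo [p] the second number is [m - 1], which is 1 or 2, and [p > 4]. *)
have co : coprimez q (q - 1 + m%:Z).
  rewrite /q coprimez_pexpl // coprimezE /= prime_coprime //.
  rewrite -[X in (X %| _)%N]/(absz p%:Z) -dvdzE -addrA rpredDl ?dvdz_exp //.
  rewrite dvdzE; have -> : absz (- 1 + m%:Z) = m.-1 by lia.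
  by rewrite gtnNdvd; lia.
have : (q %| P)%Z by rewrite -(Gauss_dvdzl _ co) eq1 dvdz_mulr.
case/dvdzP=> j DP.
have eq2 : j * (q - 1 + m%:Z) = 2 * m%:Z.
  by apply: (@mulfI _ q); [lia | rewrite -eq1 DP; ring].
have [j0|[j1|j1]] : j = 0 \/ j = 1 \/ j = -1.
  by apply: (small_multiple q_gt0); rewrite -DP.
all: by move: eq2; rewrite ?j0 ?j1; lia.
Qed.

(** Put [t = D E], [r = D + E], [q = p^n]. For [m = 0] the relation reads [t = q (q - r)], which the
    size bounds exclude, and for [m = 1] it gives [t = 0]. For [m > 1] and [t != 0], comparing
    powers of [p] shows that [p q] divides [t]; writing [t = z p q], the signs and sizes force
    [-2 <= z p < 0], although [p >= 5]. *)
Lemma product_eq0 (p n m : nat) (D E : int) : prime p -> (4 < p)%N ->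
  (p%:Z %| D)%Z -> (p%:Z %| E)%Z -> (m <= p ^ n)%N -> (0 < n)%N ->
  4 * (D ^+ 2 + E ^+ 2) <= (p%:Z ^+ n) ^+ 2 ->
  ((p%:Z ^+ n) ^+ 2 - (p%:Z ^+ n * (D + E) - (p%:Z ^+ n - 1) * (D * E))) *
    (m%:Z - 1) = - (p%:Z ^+ n * (D * E)) ->
  D * E = 0.
Proof.
move=> p_pr p_gt4 dvD dvE; case: n => // n le_mq _.
set q := p%:Z ^+ n.+1 => leDE.
have q_gt0 : 0 < q by rewrite exprn_gt0 // ltz_nat prime_gt0.
have le_mqZ : m%:Z <= q by rewrite /q; lia.
have dvS : (p%:Z %| D + E - q)%Z by rewrite rpredB ?rpredD ?dvdz_exp.
have ge_q : - q <= D + E.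
  rewrite leNgt; apply/negP => lt_q.
  have : q ^+ 2 < (D + E) ^+ 2 by clear -lt_q q_gt0; nia.
  have : 0 <= (D - E) ^+ 2 by apply: sqr_ge0.
  by clear -leDE; lia.
have DE_le : 8 * (D * E) <= q ^+ 2.
  have : 0 <= (D - E) ^+ 2 by apply: sqr_ge0.
  by clear -leDE; lia.
have S_le : 2 * (D + E) ^+ 2 <= q ^+ 2.
  have : 0 <= (D - E) ^+ 2 by apply: sqr_ge0.
  by clear -leDE; lia.
move: (D * E) (D + E) dvS ge_q DE_le S_le => t r dvS ge_q t_le r_le.
case: m le_mq le_mqZ => [|[|j]] le_mq le_mqZ eq_t.
- exfalso; have {}eq_t : t = q * (q - r).
    by clear -eq_t; lia.
  have : 7 * q <= 8 * r by rewrite -(ler_pM2l q_gt0); clear -eq_t t_le; lia.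
  by clear -r_le q_gt0; nia.
- move/eqP: eq_t; rewrite mulr0 eq_sym oppr_eq0 mulf_eq0 => /orP[|/eqP //].
  by clear -q_gt0; lia.
have [-> //|t_neq0] := eqVneq t 0; exfalso.
(* From here on [j.+1] is [m - 1]. *)
have eq1 : t * (q * j.+1%:Z + q - j.+1%:Z) = q * j.+1%:Z * (r - q).
  by clear -eq_t; lia.
have [a [j' [Dj pj']]] := int_ppart p_pr (isT : j.+1%:Z != 0).
have lt_an : (a < n.+1)%N.
  rewrite ltnNge; apply/negP => le_na.
  have : (q %| j.+1%:Z)%Z by rewrite Dj -(subnKC le_na) exprD -mulrA dvdz_mulr.
  rewrite dvdzE => /dvdn_leq -/(_ isT); clear -le_mqZ; lia.
have pa_neq0 : p%:Z ^+ a != 0 by rewrite expf_neq0 // eqz_nat -lt0n prime_gt0.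
have Dq : q = p%:Z ^+ a * p%:Z ^+ (n.+1 - a) by rewrite -exprD subnKC // ltnW.
have eq2 : t * (q * j' + p%:Z ^+ (n.+1 - a) - j') = q * j' * (r - q).
  apply: (mulfI pa_neq0); transitivity (q * j.+1%:Z * (r - q)).
    by rewrite -eq1 Dj {3}Dq; ring.
  by rewrite Dj; ring.
have : (p%:Z ^+ n.+2 %| t)%Z.
  (* Once the [p]-part of [m - 1] is removed, the cofactor of [t] is [- j'] modulo [p]; on the right
     [q] gives one full power and [r - q] one more factor [p]. *)
  have co : coprimez (p%:Z ^+ n.+2) (q * j' + p%:Z ^+ (n.+1 - a) - j').
    rewrite coprimez_pexpl // coprimezE prime_coprime // -[p in (p %| _)%N]/(absz p%:Z).
    rewrite -dvdzE rpredBl // rpredD //; first by rewrite dvdz_mulr ?dvdz_exp.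
    by rewrite dvdz_exp // subn_gt0.
  rewrite -(Gauss_dvdzl _ co) eq2 -mulrA exprSr dvdz_mul // dvdz_mull //.
case/dvdzP=> z Dt.
have z_neq0 : z != 0 by apply: contraNneq t_neq0 => z0; rewrite Dt z0 mul0r.
have Dt' : t = z * p%:Z * q by rewrite Dt exprS mulrA.
have j_gt0 : 0 < q * j.+1%:Z by rewrite mulr_gt0.
have bd : z * p%:Z * (q * j.+1%:Z + (q - j.+1%:Z)) = j.+1%:Z * (r - q).
  apply: (@mulfI _ q); first by rewrite gt_eqF.
  by move: eq1; rewrite Dt'; clear; lia.
have r_ge : - (2 * q * j.+1%:Z) <= j.+1%:Z * (r - q).
  by clear -ge_q; nia.
have r_lt : j.+1%:Z * (r - q) < 0.
  rewrite pmulr_rlt0 // subr_lt0 ltNge; apply/negP => q_le.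
  by clear -q_le r_le q_gt0; nia.
have X_ge : q * j.+1%:Z <= q * j.+1%:Z + (q - j.+1%:Z).
  by clear -le_mqZ; lia.
rewrite -{}bd in r_ge r_lt.
move: (q * j.+1%:Z + (q - j.+1%:Z)) X_ge r_ge r_lt => X X_ge r_ge r_lt.
have zp_le : z * p%:Z <= -5.
  have : z * p%:Z < 0 by clear -r_lt X_ge j_gt0; nia.
  by rewrite pmulr_llt0 ?ltz_nat ?prime_gt0 //; clear -p_gt4; nia.
by clear -r_ge X_ge j_gt0 zp_le; nia.
Qed.

(* With [D] the nonzero integer value, [q = Q D], [Dl = (a - b)^2], and [N] the
   multiplicity of [a], the last two hypotheses are the second and fourth
   moments; together they force [T = - Q (Q - 2)]. *)
Lemma fourth_moment_arith (N T D Q nu Dl : int) :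
  0 < D -> 2 < Q -> 0 < N -> 0 < nu ->
  2 * Q * nu = Q * D - T -> N * Dl = (Q * D) ^+ 2 ->
  2 * D * (Q * D - N * T) = (Q * D) ^+ 2 - N * T ^+ 2 ->
  8 * (Q * D) ^+ 2 * (2 * nu * (Q - 1) ^+ 2 + (T + nu) ^+ 2 + nu ^+ 2) =
    N * (T ^+ 4 + 6 * T ^+ 2 * Dl + Dl ^+ 2) + 8 * (Q * D - N * T) * D ^+ 3 ->
  N * (Q ^+ 2 - 2 * Q + 2 * D) = D ^+ 2.
Proof.
move=> D0 Q2 N0 nu0 eqT eqDl eq1 eq4.
pose t := D - 2 * nu.
have DT : T = Q * t by rewrite /t; clear -eqT; lia.
have nut : 2 * nu = D - t by rewrite /t; lia.
have E1 : N * t * (Q * t - 2 * D) = D ^+ 2 * (Q - 2).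
  apply: (@mulfI _ Q); first by clear -Q2; lia.
  by move: eq1; rewrite DT; clear; lia.
have E2 : 8 * Q * D ^+ 2 * N * (2 * (D - t) * (Q - 1) ^+ 2 + 2 * Q ^+ 2 * t ^+ 2
    + 2 * Q * t * (D - t) + (D - t) ^+ 2) =
    2 * (N ^+ 2 * Q ^+ 3 * t ^+ 4 + 6 * N * Q ^+ 3 * t ^+ 2 * D ^+ 2 +
     Q ^+ 3 * D ^+ 4 + 8 * N * (D - N * t) * D ^+ 3).
  apply: (@mulfI _ Q); first by clear -Q2; lia.
  have -> : Q * (2 * (N ^+ 2 * Q ^+ 3 * t ^+ 4 + 6 * N * Q ^+ 3 * t ^+ 2 * D ^+ 2 +
     Q ^+ 3 * D ^+ 4 + 8 * N * (D - N * t) * D ^+ 3)) =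
     2 * N * (N * (T ^+ 4 + 6 * T ^+ 2 * Dl + Dl ^+ 2) + 8 * (Q * D - N * T) * D ^+ 3).
    transitivity (2 * (N ^+ 2 * T ^+ 4 + 6 * N * T ^+ 2 * (N * Dl) + (N * Dl) ^+ 2
       + 8 * N * (Q * D - N * T) * D ^+ 3)); last by ring.
    by rewrite eqDl DT; ring.
  by rewrite -eq4 -nut DT; have -> : D = t + 2 * nu; [rewrite /t|]; ring.
have E3 : 2 * N * (D - t) * ((Q - 1) ^+ 2 + Q * t) = D ^+ 2 - N * t ^+ 2.
  apply: (@mulfI _ (8 * Q * D ^+ 2)).
    by rewrite !mulf_neq0 ?expf_neq0 //; clear -Q2 D0; lia.
  (* [8 Q D^2 (lhs - rhs) = E2 + (8 D^2 N + 2 Q (e1 + 4 D (N t - D))) e1] *)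
  apply/eqP; rewrite -subr_eq0; apply/eqP.
  set e1 := N * t * (Q * t - 2 * D) - D ^+ 2 * (Q - 2).
  have e10 : e1 = 0 by rewrite /e1 E1 subrr.
  move/eqP: E2; rewrite -subr_eq0 => /eqP E2.
  rewrite -[RHS](mulr0 (8 * D ^+ 2 * N + 2 * Q * (e1 + 4 * D * (N * t - D)))).
  by rewrite -{1}e10 -[RHS]addr0 -E2 /e1; ring.
(* [E1] eliminates [D^2 (Q - 2)] from [Q (Q - 2)] times [E3]; what remains has the common factor
   [2 N Q (D - t)], nonzero because [D - t = 2 nu]. *)
have E4 : (Q - 2) * ((Q - 1) ^+ 2 + Q * t) = - t.
  apply: (@mulfI _ (2 * N * (D - t) * Q)).
    by rewrite !mulf_neq0 //; clear -Q2 N0 nut nu0; lia.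
  have /(congr1 (fun z => (Q * (Q - 2)) * z)) := E3.
  have /(congr1 (fun z => (Q - 2) * z)) := E1.
  have /(congr1 (fun z => 2 * z)) := E1.
  have /(congr1 (fun z => Q * z)) := E1.
  by clear; lia.
(* [E4] is [(Q - 1)^2 (t + Q - 2) = 0]. *)
have {E4} Et : t = - (Q - 2).
  apply: (@mulfI _ ((Q - 1) ^+ 2)); first by rewrite expf_neq0 //; clear -Q2; lia.
  by move: E4; clear; lia.
apply: (@mulfI _ (Q - 2)); first by clear -Q2; lia.
by move: E1; rewrite Et; clear; lia.
Qed.

(** Dividing by the common power of [p] leaves, when [a != b], a factor that is [2] or [-2] modulo
    [p] yet divides a power of [p]; it would have to be a unit, but it is too large. When [a = b]
    the equation reduces to [p^k = 1]. *)
Lemma prime_power_arith (p a b k : nat) : prime p -> (2 < p)%N -> (0 < k)%N -> (0 < b)%N ->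
  p%:Z ^+ k * ((p%:Z ^+ b) ^+ 2 - 2 * p%:Z ^+ b + 2 * p%:Z ^+ a) != (p%:Z ^+ a) ^+ 2.
Proof.
move=> p_pr p_gt2 k_gt0 b_gt0; apply/eqP => eqp.
have p_neq0 i : p%:Z ^+ i != 0 by rewrite expf_neq0 // eqz_nat -lt0n prime_gt0.
have p_gt1 i : (0 < i)%N -> 3 <= p%:Z ^+ i.
  by case: i => // i _; rewrite exprS; have : 0 < p%:Z ^+ i; [rewrite exprn_gt0|]; nia.
have dvp i : (0 < i)%N -> (p%:Z %| p%:Z ^+ i)%Z by move=> ?; rewrite dvdz_exp.
have pN2 : ~~ (p%:Z %| 2)%Z by rewrite dvdzE gtnNdvd.
have unit_dv (z : int) i : (z %| p%:Z ^+ i)%Z -> ~~ (p%:Z %| z)%Z -> absz z = 1%N.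
  rewrite !dvdzE abszX => /(dvdn_pfactor _ _ p_pr)[j _ /= ->].
  by case: j => //= j; rewrite dvdn_exp.
have [lt_ba|lt_ab|eq_ab] := ltngtP b a.
- have eq1 : p%:Z ^+ k * (p%:Z ^+ b - 2 + 2 * p%:Z ^+ (a - b)) = p%:Z ^+ (a + (a - b)).
    apply: (mulfI (p_neq0 b)).
    transitivity ((p%:Z ^+ a) ^+ 2); last first.
      by rewrite -exprM -exprD; congr (_ ^+ _); lia.
    have Da : p%:Z ^+ a = p%:Z ^+ b * p%:Z ^+ (a - b) by rewrite -exprD subnKC // ltnW.
    by rewrite -eqp Da; ring.
  have := unit_dv (p%:Z ^+ b - 2 + 2 * p%:Z ^+ (a - b)) (a + (a - b)%N)%N.
  rewrite -eq1 dvdz_mull // addrAC rpredBl; last first.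
    by rewrite rpredD ?dvp // dvdz_mull ?dvp ?subn_gt0.
  by move/(_ isT pN2); have := p_gt1 _ b_gt0; have := p_gt1 (a - b)%N; lia.
- have eq1 : p%:Z ^+ k * (p%:Z ^+ (b - a) * (p%:Z ^+ b - 2) + 2) = p%:Z ^+ a.
    apply: (mulfI (p_neq0 a)); rewrite -[RHS]expr2 -eqp.
    have Db : p%:Z ^+ b = p%:Z ^+ a * p%:Z ^+ (b - a) by rewrite -exprD subnKC // ltnW.
    by rewrite Db; ring.
  have := unit_dv (p%:Z ^+ (b - a) * (p%:Z ^+ b - 2) + 2) a.
  rewrite -eq1 dvdz_mull // rpredDl; last first.
    by rewrite dvdz_mulr ?dvp ?subn_gt0.
  have := p_gt1 _ b_gt0; have := p_gt1 (b - a)%N.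
  rewrite subn_gt0 => /(_ lt_ab); move: (p%:Z ^+ (b - a)) (p%:Z ^+ b).
  by clear -pN2 => x y x3 y3 /(_ isT pN2); nia.
move/eqP: eqp; rewrite eq_ab addrNK -[X in _ == X]mul1r.
rewrite -subr_eq0 -mulrBl mulf_eq0 expf_eq0 (negPf (p_neq0 _)) andbF orbF subr_eq0.
by have := p_gt1 _ k_gt0; lia.
Qed.

(** * Fourier transforms and power moments *)

Section PowerMap.

Variables (K : finFieldType) (s : nat).
Hypotheses (s_gt0 : (0 < s)%N) (co_s : coprime s #|K|.-1).

Lemma power_map_root : exists t : nat, forall x : K, x ^+ (s * t) = x.
Proof.
have q1_gt0 : (0 < #|K|.-1)%N by rewrite -subn1 subn_gt0 finNzRing_gt1.
case: (egcdnP #|K|.-1 s_gt0) => t v eq_t _; exists t => x.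
have -> : (s * t = v * #|K|.-1 + 1)%N by rewrite mulnC eq_t (eqP co_s).
have [->|x0] := eqVneq x 0; first by rewrite addn1 expr0n.
rewrite exprD expr1 mulnC exprM (_ : x ^+ #|K|.-1 = 1) ?expr1n ?mul1r //.
by apply: (mulfI x0); rewrite mulr1 -exprS prednK ?expf_card ?(ltnW (finNzRing_gt1 _)).
Qed.

Lemma power_map_inj : injective (fun x : K => x ^+ s).
Proof.
have [t Dt] := power_map_root => x y eqxy.
by rewrite -[x]Dt -[y]Dt !exprM eqxy.
Qed.

Lemma power_map_eq1 (x : K) : (x ^+ s == 1) = (x == 1).
Proof. by rewrite -{1}(expr1n _ s) (inj_eq power_map_inj). Qed.

End PowerMap.

Section Character.

Variables (K : finFieldType) (chi : K -> algC).
Hypotheses (chi0 : chi 0 = 1) (chiD : forall x y, chi (x + y) = chi x * chi y).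
Hypothesis (chi_nt : exists x, chi x != 1).
Notation q := (#|K|%:R : algC).

Lemma card_neq0 : q != 0.
Proof. by rewrite pnatr_eq0 -lt0n ltnW ?finNzRing_gt1. Qed.

Lemma chiMn x k : chi (x *+ k) = chi x ^+ k.
Proof. by elim: k => [|k IHk]; rewrite ?mulr0n // mulrS chiD IHk exprS. Qed.

Lemma chiNM x : chi (- x) * chi x = 1.
Proof. by rewrite -chiD addNr. Qed.

Lemma sum_chi a : \sum_x chi (a * x) = q * (a == 0)%:R.
Proof.
have [->|a0] := eqVneq a 0.
  rewrite mulr1 -[RHS]mulr1 mulrC mulr_natr -sumr_const.
  by apply: eq_bigr => x _; rewrite mul0r.
rewrite mulr0; transitivity (\sum_x chi x).
  by rewrite [RHS](reindex_inj (mulfI a0)).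
have [y y1] := chi_nt; apply: (mulfI (_ : chi y - 1 != 0)).
  by rewrite subr_eq0.
rewrite mulr0 mulrBl mul1r [X in _ - X](reindex_inj (addrI y)) /=.
by apply/eqP; rewrite subr_eq0 mulr_sumr; apply/eqP/eq_bigr => x _; rewrite chiD.
Qed.

(** Exchanging the sums and using orthogonality in [u] keeps only the zeros of [f]. Inversion,
    Parseval and the correlations of [W] all come from this. *)
Lemma sum_chi_sub (I : finType) (h : K -> I -> algC) (f : I -> K) (G : I -> algC) :
  (forall u i, h u i = G i * chi (f i * u)) ->
  \sum_u \sum_i h u i = q * \sum_(i | f i == 0) G i.
Proof.
move=> Dh; rewrite exchange_big /= mulr_sumr [RHS]big_mkcond /=.
apply: eq_bigr => i _; rewrite (eq_bigr _ (fun u _ => Dh u i)) -mulr_sumr sum_chi.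
by case: eqP; rewrite (mulr1, mulr0) ?mulr0 // mulrC.
Qed.

Definition fourier (f : K -> algC) (b : K) : algC := \sum_c f c * chi (b * c).

Lemma fourierK f c : \sum_b fourier f b * chi (- (b * c)) = q * f c.
Proof.
under eq_bigr do rewrite mulr_suml.
rewrite (@sum_chi_sub _ _ (fun d => d - c) f) => [|u d].
  rewrite (eq_bigl (pred1 c)) ?big_pred1_eq // => d.
  by rewrite subr_eq0.
by rewrite -mulrA -chiD; congr (_ * chi _); ring.
Qed.

(** Evaluating the second factor at [- b] replaces complex conjugation, so the identity is
    bilinear. *)
Lemma fourier_parseval f : \sum_b fourier f b * fourier f (- b) = q * \sum_c f c ^+ 2.
Proof.
under eq_bigr => b _ do rewrite mulr_suml.
under eq_bigr => b _ do under eq_bigr => c _ do rewrite mulr_sumr.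
rewrite exchange_big mulr_sumr; apply: eq_bigr => c _ /=.
rewrite (@sum_chi_sub _ _ (fun d => c - d) (fun d => f c * f d)) => [|u d].
  rewrite (eq_bigl (pred1 c)) ?big_pred1_eq // => d.
  by rewrite subr_eq0 eq_sym.
by rewrite mulrACA -chiD; congr (_ * chi _); ring.
Qed.

Lemma fourierD f g b :
  fourier (fun c => f c + g c) b = fourier f b + fourier g b.
Proof. by rewrite -big_split; apply: eq_bigr => c _; rewrite mulrDl. Qed.

Lemma fourierZ k f b : fourier (fun c => k * f c) b = k * fourier f b.
Proof. by rewrite mulr_sumr; apply: eq_bigr => c _; rewrite mulrA. Qed.

Lemma fourierN f b : fourier (fun c => f (- c)) b = fourier f (- b).
Proof.
rewrite /fourier (reindex_inj (@oppr_inj _)); apply: eq_bigr => c _ /=.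
by rewrite opprK mulrN mulNr.
Qed.

Lemma fourier_delta e b : fourier (fun c => (c == e)%:R) b = chi (b * e).
Proof.
rewrite /fourier (bigD1 e) //= eqxx mul1r big1 ?addr0 // => c /negPf->.
by rewrite mul0r.
Qed.

(** Only the frequency 0 survives in the inversion formula. *)
Lemma fourier_const f c d :
  (forall b, b != 0 -> fourier f b = 0) -> f c = f d.
Proof.
move=> f0; have Df e : q * f e = fourier f 0.
  rewrite -fourierK (bigD1 0) //= big1 => [|b /f0->]; last by rewrite mul0r.
  by rewrite addr0 mul0r oppr0 chi0 mulr1.
by apply: (mulfI card_neq0); rewrite !Df.
Qed.

(** * Correlations and moments of the Weil sums *)

Section WeilSum.

Variable s : nat.
Hypotheses (s_gt0 : (0 < s)%N) (co_s : coprime s #|K|.-1).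

Definition weil (u : K) : algC := \sum_x chi (x ^+ s - u * x).
Local Notation W := weil.

Lemma sum_power (F : K -> algC) : \sum_x F (x ^+ s) = \sum_x F x.
Proof. by rewrite [RHS](reindex_inj (power_map_inj s_gt0 co_s)). Qed.

Lemma weil0 : W 0 = 0.
Proof.
transitivity (\sum_x chi (1 * x)); last by rewrite sum_chi oner_eq0 mulr0.
rewrite -sum_power; apply: eq_bigr => x _.
by rewrite mul0r subr0 mul1r.
Qed.

Lemma sum_weil_chi a : \sum_u W u * chi (u * a) = q * chi (a ^+ s).
Proof.
under eq_bigr do rewrite mulr_suml.
rewrite (@sum_chi_sub _ _ (fun x => a - x) (fun x => chi (x ^+ s))) => [|u x].
  rewrite (eq_bigl (pred1 a)) ?big_pred1_eq // => x.
  by rewrite subr_eq0 eq_sym.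
by rewrite -!chiD; congr chi; ring.
Qed.

Lemma sum_weil : \sum_u W u = q.
Proof.
have := sum_weil_chi 0; rewrite expr0n gtn_eqF // chi0 mulr1 => <-.
by apply: eq_bigr => u _; rewrite mulr0 chi0 mulr1.
Qed.

(** Summation over [u] forces [x = a - e y] in the product of the two sums. The choice [a = 0] gives
    the correlations under scaling, and [e = 1], [e = -1] the transforms of [W u ^+ 2] and
    [W u * W (- u)]. *)
Lemma sum_weil2_chi e a :
  \sum_u W u * W (e * u) * chi (u * a) = q * \sum_y chi ((a - e * y) ^+ s + y ^+ s).
Proof.
under eq_bigr => u _ do rewrite mulr_suml mulr_suml.
under eq_bigr => u _ do under eq_bigr => x _ do rewrite mulr_sumr mulr_suml.
under eq_bigr => u _ do rewrite exchange_big /=.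
rewrite exchange_big mulr_sumr; apply: eq_bigr => y _ /=.
rewrite (@sum_chi_sub _ _ (fun x => a - e * y - x)
                          (fun x => chi (x ^+ s + y ^+ s))) => [|u x].
  rewrite (eq_bigl (pred1 (a - e * y))) ?big_pred1_eq // => x.
  by rewrite subr_eq0 eq_sym.
by rewrite -!chiD; congr chi; ring.
Qed.

Hypothesis odd_s : odd s.

Lemma exprN_odd (x : K) : (- x) ^+ s = - x ^+ s.
Proof. by rewrite exprNn -signr_odd odd_s mulN1r. Qed.

(** For odd [s] the exponent at [a = 0] is [(1 - e^s) y^s], and [y^s] runs over all of [K]; also
    [e^s = 1] only for [e = 1]. *)
Lemma sum_weil_mul e : \sum_u W u * W (e * u) = q ^+ 2 * (e == 1)%:R.
Proof.
transitivity (\sum_u W u * W (e * u) * chi (u * 0)).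
  by apply: eq_bigr => u _; rewrite mulr0 chi0 mulr1.
rewrite sum_weil2_chi expr2 -mulrA; congr (_ * _).
transitivity (\sum_y chi ((1 - e ^+ s) * y ^+ s)).
  by apply: eq_bigr => y _; rewrite sub0r exprN_odd exprMn; congr chi; ring.
rewrite (sum_power (fun y => chi (_ * y))) sum_chi subr_eq0 eq_sym.
by rewrite (power_map_eq1 s_gt0 co_s).
Qed.

Lemma sum_weil2 : \sum_u W u ^+ 2 = q ^+ 2.
Proof.
have := sum_weil_mul 1; rewrite eqxx mulr1 => <-.
by apply: eq_bigr => u _; rewrite mul1r.
Qed.

(** Summation over [u] forces [x = - y], so the two [s]-th powers cancel and a nontrivial linear
    character sum remains. *)
Lemma sum_weil_shift d : d != 0 -> \sum_u W u * W (u + d) = 0.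
Proof.
move=> d0; under eq_bigr => u _ do rewrite mulr_suml.
under eq_bigr => u _ do under eq_bigr => x _ do rewrite mulr_sumr.
under eq_bigr => u _ do rewrite exchange_big /=.
rewrite exchange_big /=; transitivity (q * \sum_y chi (- d * y)); last first.
  by rewrite sum_chi oppr_eq0 (negPf d0) !mulr0.
rewrite mulr_sumr; apply: eq_bigr => y _.
rewrite (@sum_chi_sub _ _ (fun x => - y - x)
                          (fun x => chi (x ^+ s + y ^+ s - d * y))) => [|u x].
  rewrite (eq_bigl (pred1 (- y))) ?big_pred1_eq => [|x].
    by rewrite exprN_odd; congr (_ * chi _); ring.
  by rewrite subr_eq0 eq_sym.
by rewrite -!chiD; congr chi; ring.
Qed.

(** The hypothesis makes the correlation at [u / v] equal to [q^2], and it vanishes unless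
    [u / v = 1]. *)
Lemma weil_ext u v : (forall w, W (u * w) = W (v * w)) -> v != 0 -> u = v.
Proof.
move=> eqW v0; apply/eqP; rewrite -(inj_eq (mulIf (invr_neq0 v0))) divff //.
have := sum_weil_mul (u / v); rewrite (eq_bigr (fun w => W w ^+ 2)) => [|w _].
  rewrite sum_weil2; case: eqP => // _ /eqP.
  by rewrite mulr0 expf_eq0 (negPf card_neq0).
by rewrite -mulrA eqW mulVKf // expr2.
Qed.

(** These fiber counts are the Fourier counterparts of [W u ^+ 2] and [W u * W (- u)]: relations
    between values of [W] become linear relations between counts. *)
Definition fsum c := #|[set t : K | t ^+ s + (1 - t) ^+ s == c]|.
Definition fdif c := #|[set t : K | t ^+ s - (1 - t) ^+ s == c]|.

Lemma fourier_card (f : K -> K) b :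
  fourier (fun c => #|[set t | f t == c]|%:R) b = \sum_t chi (b * f t).
Proof.
rewrite [RHS](partition_big f xpredT) //=; apply: eq_bigr => c _.
rewrite [RHS](eq_bigr (fun=> chi (b * c))) => [|t /eqP-> //].
by rewrite sumr_const -[RHS]mulr_natl cardsE.
Qed.

Lemma sum_card_fiber (f : K -> K) : (\sum_c #|[set t | f t == c]| = #|K|)%N.
Proof.
rewrite -[RHS]sum1_card [RHS](partition_big f xpredT) //=; apply: eq_bigr => c _.
by rewrite cardsE -sum1_card; apply: eq_bigl.
Qed.

Lemma sum_weil2_fsum a :
  \sum_u W u ^+ 2 * chi (u * a) = q * fourier (fun c => (fsum c)%:R) (a ^+ s).
Proof.
rewrite fourier_card; transitivity (\sum_u W u * W (1 * u) * chi (u * a)).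
  by apply: eq_bigr => u _; rewrite mul1r.
rewrite sum_weil2_chi; congr (_ * _); have [->|a0] := eqVneq a 0.
  apply: eq_bigr => y _; rewrite mul1r sub0r exprN_odd addNr chi0.
  by rewrite expr0n gtn_eqF // mul0r chi0.
rewrite (reindex_inj (mulfI a0)); apply: eq_bigr => t _ /=; congr chi.
by rewrite mul1r -{1}[a]mulr1 -mulrBr !exprMn; ring.
Qed.

(** The substitution is [y = a (t - 1)]. At [a = 0] the identity fails in odd characteristic: the
    left side is the correlation at [-1], which is 0, and the right side is [q^2]. *)
Lemma sum_weilN_fdif a : a != 0 ->
  \sum_u W u * W (- u) * chi (u * a) = q * fourier (fun c => (fdif c)%:R) (a ^+ s).
Proof.
move=> a0; rewrite fourier_card.
transitivity (\sum_u W u * W (-1 * u) * chi (u * a)).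
  by apply: eq_bigr => u _; rewrite mulN1r.
rewrite sum_weil2_chi; congr (_ * _).
rewrite (reindex_inj (mulfI a0)) (reindex_inj (addIr (-1))) /=.
apply: eq_bigr => t _; congr chi.
rewrite (_ : a - -1 * (a * (t - 1)) = a * t); last by ring.
by rewrite -opprB mulrN exprN_odd !exprMn; ring.
Qed.

(** Parseval for [W u ^+ 2], reindexed by [b = a^s]; as [s] is odd, [- b] corresponds to [- a]. *)
Lemma sum_weil4 : \sum_u W u ^+ 4 = q ^+ 2 * \sum_c (fsum c)%:R ^+ 2.
Proof.
pose n := fourier (fun c => (fsum c)%:R).
apply: (mulfI card_neq0); transitivity (\sum_b (q * n b) * (q * n (- b))).
  rewrite -(sum_power (fun b => (q * n b) * (q * n (- b)))).
  under [RHS]eq_bigr => a _ do rewrite -exprN_odd -!sum_weil2_fsum.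
  transitivity (q * \sum_u (W u ^+ 2) ^+ 2).
    by congr (_ * _); apply: eq_bigr => u _; rewrite -exprM.
  rewrite -fourier_parseval; apply: eq_bigr => a _.
  by congr (_ * _); apply: eq_bigr => u _; congr (_ * chi _); ring.
rewrite (eq_bigr (fun b => q ^+ 2 * (n b * n (- b)))) => [|b _]; last by ring.
by rewrite -mulr_sumr fourier_parseval; ring.
Qed.

End WeilSum.
End Character.

(** * Fibers of [t^s + (1 - t)^s] and [t^s - (1 - t)^s] *)

(** Taking the element of smaller rank in each orbit splits [A] into [B] and its image. *)
Lemma card_involution_even (T : finType) (f : T -> T) (A : {set T}) :
  involutive f -> (forall x, x \in A -> f x \in A) ->
  (forall x, x \in A -> f x != x) -> ~~ odd #|A|.
Proof.
move=> fK fA fneq.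
pose B := [set x in A | (enum_rank x < enum_rank (f x))%N].
have -> : A = B :|: f @: B.
  apply/setP=> x; rewrite in_setU -{3}[x]fK (mem_imset _ _ (inv_inj fK)) !inE fK.
  have -> : (f x \in A) = (x \in A).
    by apply/idP/idP => [/fA|/fA //]; rewrite fK.
  rewrite -andb_orr -neq_ltn; case xA: (x \in A) => //=.
  by rewrite val_eqE (inj_eq enum_rank_inj) eq_sym fneq.
rewrite cardsU (card_imset _ (inv_inj fK)) disjoint_setI0 ?cards0 ?subn0.
  by rewrite addnn odd_double.
apply/pred0P=> x; rewrite /= -{2}[x]fK (mem_imset _ _ (inv_inj fK)) !inE fK.
by case: ltngtP; rewrite ?andbF.
Qed.

Section FiberCounts.

Variables (K : finFieldType) (s : nat).
Hypotheses (s_gt0 : (0 < s)%N) (co_s : coprime s #|K|.-1) (odd_s : odd s).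
Hypothesis two_neq0 : 2%:R != 0 :> K.
Notation powI := (power_map_inj s_gt0 co_s).
Notation expN := (exprN_odd odd_s).

Lemma fsum0 : fsum s (0 : K) = 0%N.
Proof.
apply: eq_card0 => t; rewrite inE addr_eq0 -expN opprB (inj_eq powI).
by rewrite -subr_eq0 opprB addrC subrK oner_eq0.
Qed.

Lemma fdif0 : fdif s (0 : K) = 1%N.
Proof.
rewrite /fdif -(cards1 (2%:R^-1 : K)); congr #|pred_of_set _|; apply/setP=> t.
rewrite !inE subr_eq0 (inj_eq powI) -[RHS](inj_eq (mulIf two_neq0)) mulVf //.
by rewrite -[LHS]subr_eq0 -[RHS]subr_eq0; congr (_ == _); ring.
Qed.

Lemma fdifN (c : K) : fdif s (- c) = fdif s c.
Proof.
rewrite /fdif -(card_imset _ (inv_inj (@subKr K 1))); congr #|pred_of_set _|.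
apply/setP=> t; rewrite -{1}[t](subKr 1) (mem_imset _ _ (inv_inj (@subKr K 1))).
by rewrite !inE subKr -eqr_opp opprB opprK.
Qed.

(* The bijection [z |-> 1 - z^-1] maps the fiber of [t^s + (1 - t)^s] at [-1] to
   that of [t^s - (1 - t)^s] at [1], and the junk value [0^-1 = 0] makes it send
   [0] to the one missing point [1]. *)
Lemma fdif1 : fdif s (1 : K) = (fsum s (-1 : K)).+1.
Proof.
pose f (z : K) := 1 - z^-1.
have fI : injective f by move=> x y /addrI/oppr_inj/invr_inj.
rewrite /fsum; set B := [set t | _].
have B0 : 0 \notin B.
  by rewrite inE expr0n gtn_eqF // add0r subr0 expr1n -subr_eq0 opprK.
have -> : #|B|.+1 = #|0 |: B| by rewrite cardsU1 B0.
rewrite -(card_imset _ fI) /fdif; congr #|pred_of_set _|; apply/setP=> t.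
have Dt : t = f (1 - t)^-1 by rewrite /f invrK subKr.
rewrite [in RHS]Dt (mem_imset _ _ fI) !inE invr_eq0 subr_eq0 eq_sym.
have [->|t1] /= := eqVneq t 1.
  by rewrite subrr expr0n gtn_eqF // subr0 expr1n eqxx.
have z0 : 1 - t != 0 by rewrite subr_eq0 eq_sym.
rewrite -[RHS](inj_eq (mulIf (expf_neq0 s z0))) mulN1r mulrDl -!exprMn mulVf // expr1n.
rewrite mulrBl mul1r mulVf // (_ : 1 - t - 1 = - t); last by ring.
by rewrite expN -[LHS]subr_eq0 -[RHS]subr_eq0; congr (_ == _); ring.
Qed.

(** The involution [t |-> 1 - t] preserves each fiber and fixes only [1/2], which lies over the
    excluded value. *)
Lemma fsum_even (c : K) : c != 2%:R * (2%:R^-1) ^+ s -> ~~ odd (fsum s c).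
Proof.
move=> c_neq; apply: (@card_involution_even _ (fun t => 1 - t)) => t.
- exact: subKr.
- by rewrite !inE subKr addrC.
rewrite inE => /eqP Dc; apply: contraNneq c_neq => Dt.
suff Et : t = 2%:R^-1 by rewrite -Dc Dt Et -mulr2n mulr_natl.
by apply: (mulIf two_neq0); rewrite mulVf // mulr_natr mulr2n -{1}Dt subrK.
Qed.

End FiberCounts.

(** * Integrality of Galois-invariant character sums *)

Lemma prim_root_prime (R : nzRingType) (z : R) m :
  prime m -> z ^+ m = 1 -> z != 1 -> m.-primitive_root z.
Proof.
move=> m_pr zm z1; have [k k_prim dv] := prim_order_exists (prime_gt0 m_pr) zm.
case/primeP: m_pr => _ /(_ k dv) /orP[/eqP k1|/eqP <- //].
by have := prim_expr_order k_prim; rewrite k1 expr1 => /eqP; rewrite (negPf z1).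
Qed.

(** * Units of the prime field *)

Section PrimeField.

Variables (K : fieldType) (p : nat).
Hypothesis pchK : p \in [pchar K].
Let rs := [seq (i%:R : K) | i <- iota 1 p.-1].

Lemma natr_units_unity : all (p.-1).-unity_root rs.
Proof.
have p_gt0 := prime_gt0 (pcharf_prime pchK).
apply/allP=> y /mapP[i]; rewrite mem_iota => /andP[i_gt0 lt_ip] ->.
rewrite unity_rootE; have i0 : (i%:R : K) != 0.
  by rewrite -(dvdn_pcharf pchK) gtnNdvd //; lia.
rewrite -(inj_eq (mulIf i0)) mul1r -exprSr prednK //.
by rewrite -(pFrobenius_autE pchK) pFrobenius_aut_nat.
Qed.

Lemma natr_eq_mod i j : (i%:R = j%:R :> K) -> i = j %[mod p].
Proof.
wlog le_ij : i j / (i <= j)%N.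
  move=> wl eq_ij; case/orP: (leq_total i j) => ?; first exact: wl.
  by apply/esym/wl.
move/esym/eqP; rewrite -subr_eq0 -natrB // -(dvdn_pcharf pchK) => dv.
by apply/esym/eqP; rewrite eqn_mod_dvd.
Qed.

Lemma natr_units_uniq : uniq rs.
Proof.
rewrite map_inj_in_uniq ?iota_uniq // => i j; rewrite !mem_iota => ip jp /natr_eq_mod.
by rewrite !modn_small //; lia.
Qed.

Lemma natr_prim_root : exists g : nat, (p.-1).-primitive_root (g%:R : K).
Proof.
have p_gt1 := prime_gt1 (pcharf_prime pchK).
have : has (p.-1).-primitive_root rs.
  apply: has_prim_root; rewrite ?size_map ?size_iota //.
  - by rewrite -subn1 subn_gt0.
  - exact: natr_units_unity.
  exact: natr_units_uniq.
by case/hasP=> _ /mapP[g _ ->] g_prim; exists g.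
Qed.

Lemma natr_units_perm (z : K) : (p.-1).-primitive_root z ->
  perm_eq [seq z ^+ i | i <- iota 0 p.-1] rs.
Proof.
move=> z_prim; have sub : {subset rs <= [seq z ^+ i | i <- iota 0 p.-1]}.
  move=> y /(allP natr_units_unity)/unity_rootP/(prim_rootP z_prim)[i ->].
  by rewrite map_f // mem_iota ltn_ord.
have sz : (size [seq z ^+ i | i <- iota 0 p.-1] <= size rs)%N.
  by rewrite !size_map !size_iota.
have [_ eq_rs] := uniq_min_size natr_units_uniq sub sz.
by rewrite perm_sym uniq_perm ?(leq_size_uniq natr_units_uniq sub sz) ?natr_units_uniq.
Qed.

End PrimeField.

Lemma sum_unity_powers (y : algC) p : y ^+ p = 1 -> \sum_(k < p) y ^+ k = p%:R * (y == 1)%:R.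
Proof.
move=> yp; case: eqP => [->|/eqP y1].
  by rewrite mulr1 (eq_bigr (fun=> 1)) ?sumr_const ?card_ord // => i _; rewrite expr1n.
apply: (mulfI (_ : y - 1 != 0)); first by rewrite subr_eq0.
by rewrite -subrX1 yp subrr !mulr0.
Qed.

Section CharacterSums.

Variables (K : finFieldType) (chi : K -> algC) (p : nat).
Hypotheses (chi0 : chi 0 = 1) (chiD : forall x y, chi (x + y) = chi x * chi y).
Hypothesis (pchK : p \in [pchar K]).

Lemma chi_unity x : chi x ^+ p = 1.
Proof. by rewrite -(chiMn chi0 chiD) mulrn_pchar. Qed.

Lemma chiN_conj x : chi (- x) = (chi x)^*.
Proof.
have p_gt0 := prime_gt0 (pcharf_prime pchK).
have nx : `|chi x| = 1.
  by apply/eqP; rewrite -(pexpr_eq1 p_gt0) // -normrX chi_unity normr1.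
rewrite -[RHS]mul1r -(chiNM chi0 chiD x) -mulrA.
by rewrite -normCK nx expr1n mulr1.
Qed.

Lemma chi_galois : exists (g : nat) (sg : {rmorphism algC -> algC}),
  (p.-1).-primitive_root (g%:R : K) /\ (forall x, sg (chi x) = chi (g%:R * x)).
Proof.
have p_pr := pcharf_prime pchK.
have [g g_prim] := natr_prim_root pchK.
have co_gp : coprime g p.
  rewrite coprime_sym prime_coprime // (dvdn_pcharf pchK); apply/eqP=> g0.
  have := prim_expr_order g_prim; rewrite g0 expr0n -subn1 subn_eq0 leqNgt prime_gt1 //=.
  by move/esym/eqP; rewrite oner_eq0.
have [sg Dsg] := Qn_aut_exists co_gp; exists g, sg; split=> // x.
by rewrite (Dsg _ (chi_unity x)) -(chiMn chi0 chiD) mulr_natl.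
Qed.

Variables (g : nat) (sg : {rmorphism algC -> algC}).
Hypotheses (g_prim : (p.-1).-primitive_root (g%:R : K))
           (Dsg : forall x, sg (chi x) = chi (g%:R * x)).

(** The powers of [g] run through [1, ..., p - 1], so the conjugates are the powers of [chi x] with
    exponents in that range; adding the missing exponent 0 gives a full geometric sum. *)
Lemma sum_galois_chi x :
  \sum_(i < p.-1) iter i sg (chi x) = p%:R * (chi x == 1)%:R - 1.
Proof.
have p_pr := pcharf_prime pchK.
transitivity (\sum_(i < p.-1) chi (g%:R ^+ i * x)).
  apply: eq_bigr => i _; elim: (i : nat) => [|k IHk]; first by rewrite mul1r.
  by rewrite iterS IHk Dsg mulrA -exprS.
transitivity (\sum_(k <- iota 1 p.-1) chi (k%:R * x)).
  rewrite -(big_mkord xpredT (fun i => chi (g%:R ^+ i * x))) /index_iota subn0.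
  rewrite -(big_map (fun i => g%:R ^+ i) xpredT (fun y => chi (y * x))).
  rewrite -[RHS](big_map (fun k => k%:R) xpredT (fun y => chi (y * x))).
  exact/perm_big/natr_units_perm.
have -> : \sum_(k <- iota 1 p.-1) chi (k%:R * x) = \sum_(k < p) chi x ^+ k - 1.
  rewrite -(big_mkord xpredT (fun k => chi x ^+ k)) /index_iota subn0.
  rewrite -{2}(prednK (prime_gt0 p_pr)) /= big_cons expr0 addrC addKr.
  by apply: eq_bigr => k _; rewrite mulr_natl (chiMn chi0 chiD).
by rewrite (sum_unity_powers (chi_unity x)).
Qed.

(* Averaging over the [p - 1] conjugates: [(p - 1) S = p k - size r], where [k]
   counts the terms equal to [1]. *)
Lemma chi_sum_int (r : seq K) :
  let S := \sum_(y <- r) chi y in sg S = S ->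
  exists2 z : int, S = z%:~R & (p%:Z %| z - (size r)%:Z)%Z.
Proof.
move=> S sgS; have p_pr := pcharf_prime pchK; have p_gt1 := prime_gt1 p_pr.
have p1_neq0 : (p.-1)%:R != 0 :> algC.
  by rewrite pnatr_eq0 -lt0n -subn1 subn_gt0.
have eqS : (p.-1)%:R * S = p%:R * (count (fun y => chi y == 1) r)%:R - (size r)%:R.
  transitivity (\sum_(i < p.-1) iter i sg S).
    rewrite (eq_bigr (fun=> S)) ?sumr_const ?card_ord ?mulr_natl // => i _.
    by elim: (i : nat) => //= k ->.
  transitivity (\sum_(y <- r) \sum_(i < p.-1) iter i sg (chi y)).
    rewrite exchange_big; apply: eq_bigr => i _ /=.
    by elim: (i : nat) => //= k ->; rewrite rmorph_sum.
  rewrite (eq_bigr _ (fun y _ => sum_galois_chi y)) big_split /= -mulr_sumr.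
  rewrite sumrN -natr_sum -sum1_count /=; congr (_ * _ - _).
    by rewrite [in RHS]big_mkcond; congr (_%:R); apply: eq_bigr => y _; case: eqP.
  by rewrite -(sum1_size r) natr_sum.
have ZS : S \in Num.int.
  apply: Cint_rat_Aint.
    rewrite -(mulKf p1_neq0 S) eqS rpredM ?rpredV ?rpredB ?rpredM ?rpred_nat //.
  by apply: rpred_sum => y _; apply: (Aint_unity_root (prime_gt0 p_pr)); apply/unity_rootP/chi_unity.
have [z Dz] := intrP ZS; exists z => //.
have : (p.-1)%:Z * z = p%:Z * (count (fun y => chi y == 1) r)%:Z - (size r)%:Z.
  apply: (@intr_inj algC); rewrite Dz in eqS.
  by rewrite rmorphB !rmorphM /= -!pmulrn eqS.
move=> eqz; have -> : z - (size r)%:Z = p%:Z * (z - (count (fun y => chi y == 1) r)%:Z).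
  have -> : p%:Z = p.-1%:Z + 1 by lia.
  by move: eqz; lia.
by rewrite dvdz_mulr.
Qed.

End CharacterSums.

(** * Traces with two values *)

(** Start from a moved point [a] and its image [b]; the other two elements are exchanged if needed
    to reach one of the four normal forms. *)
Lemma perm4_cycle_type (T : eqType) (vs : seq T) (f : T -> T) :
  uniq vs -> size vs = 4%N -> {in vs, forall x, f x \in vs} -> injective f ->
  (exists2 x, x \in vs & f x != x) ->
  exists a b c d : T, [/\ vs =i [:: a; b; c; d], uniq [:: a; b; c; d] &
    [\/ [/\ f a = b, f b = a, f c = c & f d = d],
        [/\ f a = b, f b = a, f c = d & f d = c],
        [/\ f a = b, f b = c, f c = a & f d = d] |
        [/\ f a = b, f b = c, f c = d & f d = a]]].
Proof.
move=> Uvs sz_vs fvs fI [a avs fa].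
pose b := f a; have bvs : b \in rem a vs by rewrite mem_rem_uniq // inE fa fvs.
have [c [d Dcd]] : exists c d, rem b (rem a vs) = [:: c; d].
  have : size (rem b (rem a vs)) = 2%N by rewrite !size_rem // sz_vs.
  by case: (rem b _) => [|c [|d []]] // _; exists c, d.
have perm_vs : perm_eq vs [:: a; b; c; d].
  by rewrite (permPl (perm_to_rem avs)) perm_cons -Dcd perm_to_rem.
have mem_vs := perm_mem perm_vs; have U := Uvs; rewrite (perm_uniq perm_vs) in U.
have step x : x \in vs -> f x \in [:: a; b; c; d] by move=> /fvs; rewrite mem_vs.
have := step _ (mem_rem bvs).
have cvs : c \in vs by rewrite mem_vs !inE eqxx !orbT.
have dvs : d \in vs by rewrite mem_vs !inE eqxx !orbT.
have := step _ cvs; have := step _ dvs; move: U; rewrite /= !inE !negb_or.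
rewrite -!andbA => /and5P[ab ac ad bc /and3P[bd cd _]].
have fab : f a = b by [].
have neq x y : x != y -> f x != f y by rewrite (inj_eq fI).
have := neq _ _ ab; have := neq _ _ ac; have := neq _ _ ad; have := neq _ _ bc.
have := neq _ _ bd; have := neq _ _ cd; rewrite fab => ncd nbd nbc nad nac nab.
have U4 : uniq [:: a; b; c; d] by rewrite /= !inE !negb_or ab ac ad bc bd cd.
have U4' : uniq [:: a; b; d; c].
  by rewrite /= !inE !negb_or ab ac ad bc bd eq_sym cd.
have mem_vs' : vs =i [:: a; b; d; c].
  by move=> x; rewrite mem_vs !inE [(x == c) || _]orbC.
case/or4P=> /eqP fd; case/or4P=> /eqP fc; case/or4P=> /eqP fb;
  rewrite ?fb ?fc ?fd ?eqxx // in ncd nbd nbc nad nac nab.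
all: try by exists a, b, c, d; split=> //; constructor.
all: try by exists a, b, d, c; split=> //; constructor.
all: try by exists a, b, c, d; split=> //; constructor 2.
all: try by exists a, b, c, d; split=> //; constructor 3.
all: try by exists a, b, d, c; split=> //; constructor 3.
all: try by exists a, b, c, d; split=> //; constructor 4.
all: try by exists a, b, d, c; split=> //; constructor 4.
Qed.

Section TwoValued.

Variables (K : finFieldType) (p n m : nat) (h : K) (r : K -> int) (P Q : int).
Hypotheses (p_pr : prime p) (p_gt4 : (4 < p)%N) (cardK : #|K| = (p ^ n)%N).
Hypotheses (m14 : (1 < m < 4)%N) (lt_mq : (m.+1 < #|K|)%N).
Hypothesis h_prim : m.-primitive_root h.
Hypotheses (r0 : r 0 = 0) (rh : forall u, r (h * u) = r u).
Hypotheses (sum_r : \sum_u r u = m%:Z * #|K|%:Z).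
Hypotheses (sum_r2 : \sum_u r u ^+ 2 = m%:Z * #|K|%:Z ^+ 2).
Hypothesis rPQ : forall u, u != 0 -> r u = P \/ r u = Q.
Hypotheses (exP : exists2 u, u != 0 & r u = P) (exQ : exists2 u, u != 0 & r u = Q).

Definition ray (u : K) := [set h ^+ i * u | i : 'I_m].

Lemma r_ray u v : v \in ray u -> r v = r u.
Proof.
case/imsetP=> i _ ->; elim: (i : nat) => [|k IHk]; first by rewrite mul1r.
by rewrite exprS -mulrA rh.
Qed.

Lemma card_ray u : u != 0 -> #|ray u| = m.
Proof.
move=> u0; rewrite card_imset ?card_ord // => i j /(mulIf u0)/eqP.
by rewrite (eq_prim_root_expr h_prim) !modn_small // => /eqP/val_inj.
Qed.

(** The value [r u] is taken on all [m] points of the ray, and the second moment is [m q^2]. *)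
Lemma value_bound u : u != 0 -> r u ^+ 2 <= #|K|%:Z ^+ 2.
Proof.
move=> u0; have m_gt0 : 0 < m%:Z by lia.
rewrite -(ler_pM2l m_gt0) -sum_r2 (bigID (mem (ray u))) /=.
rewrite -[leLHS]addr0 lerD ?sumr_ge0 // => [|v _]; last exact: sqr_ge0.
rewrite (eq_bigr (fun=> r u ^+ 2)) => [|v /r_ray-> //].
by rewrite sumr_const card_ray // -mulr_natl natz.
Qed.

(** The sum of [(r u - P) (r u - Q)] has only its term at 0, which gives the relation solved by
    [two_value_arith]. With values 0 and [q], the second moment says that [q] is taken exactly [m]
    times, hence on a single ray. *)
Lemma two_valued_spike :
  ((P = 0 /\ Q = #|K|%:Z) \/ (P = #|K|%:Z /\ Q = 0)) /\
  exists2 u, u != 0 & forall v, r v = if v \in ray u then #|K|%:Z else 0.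
Proof.
have n_gt0 : (0 < n)%N by case: n cardK lt_mq m14 => // ->; case: m => [|[]].
have cardZ : #|K|%:Z = p%:Z ^+ n by rewrite cardK; lia.
have eqPQ : P * Q * (p%:Z ^+ n - 1) = m%:Z * p%:Z ^+ n * (P + Q - p%:Z ^+ n).
  have : \sum_u (r u - P) * (r u - Q) = P * Q.
    rewrite (bigD1 0) //= r0 !sub0r mulrNN big1 ?addr0 // => u u0.
    by case: (rPQ u0) => ->; rewrite subrr ?mul0r ?mulr0.
  rewrite (eq_bigr (fun u => r u ^+ 2 - (P + Q) * r u + P * Q)) => [|u _]; last by ring.
  rewrite !big_split /= sumrN -mulr_sumr sum_r sum_r2 sumr_const -mulr_natl natz.
  by rewrite cardT -cardE cardZ; move: (p%:Z ^+ n) => x; clear; lia.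
have [uP uP0 DP] := exP; have [uQ uQ0 DQ] := exQ.
have PQ : (P = 0 /\ Q = #|K|%:Z) \/ (P = #|K|%:Z /\ Q = 0).
  rewrite cardZ; apply: (two_value_arith p_pr p_gt4 n_gt0 m14) => //.
  - by rewrite -cardK.
  - by rewrite -cardZ -DP value_bound.
  - by rewrite -cardZ -DQ value_bound.
split=> //; have q_gt0 : 0 < #|K|%:Z by rewrite ltz_nat ltnW ?finNzRing_gt1.
have rq v : v != 0 -> r v = 0 \/ r v = #|K|%:Z.
  by move=> v0; case: (rPQ v0) PQ => -> [[EP EQ]|[EP EQ]]; [left|right|right|left].
have [u u0 Du] : exists2 u, u != 0 & r u = #|K|%:Z.
  by case: PQ => -[? ?]; [exists uQ | exists uP]; congruence.
exists u => //.
pose A := [set v | r v == #|K|%:Z].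
have cardA : #|A| = m.
  have : #|A|%:Z * #|K|%:Z ^+ 2 = m%:Z * #|K|%:Z ^+ 2.
    rewrite -sum_r2 (bigID (mem A)) /= [X in _ = _ + X]big1 ?addr0 => [|v].
      rewrite (eq_bigr (fun=> #|K|%:Z ^+ 2)) => [|v]; last by rewrite inE => /eqP->.
      by rewrite sumr_const -mulr_natl natz.
    rewrite inE; have [->|/rq[->|->]] := eqVneq v 0; rewrite ?r0 ?eqxx //.
  move/mulIf => /(_ (expf_neq0 2 (lt0r_neq0 q_gt0))); lia.
have DA : ray u = A.
  apply/eqP; rewrite eqEcard card_ray // cardA leqnn andbT.
  by apply/subsetP=> v /r_ray; rewrite inE Du => ->.
move=> v; rewrite DA inE; case: eqP => // nv.
have [->|/rq[]] := eqVneq v 0; by rewrite ?r0.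
Qed.

End TwoValued.

(** * Integer constraints for a transposition *)

Section TranspositionArith.

Variables (K : finFieldType) (p e : nat).
Hypotheses (p_pr : prime p) (p_gt4 : (4 < p)%N) (cardK : #|K| = (p ^ e)%N).
Hypothesis two_neq0 : 2%:R != 0 :> K.
(* [ns] and [ms] stand for [fsum] and [fdif]; [a] and [b], with [T = a + b] and
   [Dl = (a - b)^2], are the swapped values, of multiplicity [N]; [C] and [E] are
   the integer values, of multiplicities [x] and [y]. *)
Variables (ns ms : K -> nat) (N x y : nat) (T C E Dl : int).
Notation q := (#|K|%:Z).
Notation nu := (ns (-1)).
Hypotheses (q_gt6 : (6 < #|K|)%N).
Hypotheses (ns0 : ns 0 = 0%N) (ms0 : ms 0 = 1%N).
Hypotheses (ms1 : ms 1 = nu.+1) (msN1 : ms (-1) = nu.+1) (ns1 : (ns 1)%:Z = T + nu%:Z).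
Hypothesis ns_even : forall c, c != 1 -> c != -1 -> ~~ odd (ns c).
Hypotheses (sum_ns : (\sum_c ns c = #|K|)%N) (sum_ms : (\sum_c ms c = #|K|)%N).
Notation Theta := (q * (C + E) - (q - 1) * (C * E)).
Hypothesis rel : forall c, c \notin [:: 0; 1; -1] ->
  Theta * (ns c)%:Z + (q ^+ 2 - Theta) * ((ms c)%:Z - 1) = - (q * (C * E)).
Hypothesis rel1 :
  Theta * T + 2 * q ^+ 2 * nu%:Z - (C + E) * q ^+ 2 + 2 * (C * E) * q = 0.
Hypotheses (dvC : (p%:Z %| C)%Z) (dvE : (p%:Z %| E)%Z) (CE : C != E).
Hypothesis bound : 4 * (C ^+ 2 + E ^+ 2) <= q ^+ 2.
Hypotheses (N_gt1 : (1 < N)%N) (NDl : N%:Z * Dl = q ^+ 2).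
Hypothesis moment1 : N%:Z * T + x%:Z * C + y%:Z * E = q.
Hypothesis moment2 : N%:Z * T ^+ 2 + 2 * x%:Z * C ^+ 2 + 2 * y%:Z * E ^+ 2 = q ^+ 2.
Hypothesis moment4 : 8 * q ^+ 2 * (\sum_c (ns c)%:Z ^+ 2) =
  N%:Z * (T ^+ 4 + 6 * T ^+ 2 * Dl + Dl ^+ 2) + 8 * (x%:Z * C ^+ 4 + y%:Z * E ^+ 4).

(** The supports of the delta terms; the relation [rel] holds off them. *)
Let S3 : seq K := [:: 0; 1; -1].

Lemma uniq_S3 : uniq S3.
Proof.
have t1 : 1 == -1 :> K = false.
  by apply/negbTE; apply: contra two_neq0; rewrite -subr_eq0 opprK.
by rewrite /S3 /= !inE eq_sym oner_eq0 eq_sym oppr_eq0 oner_eq0 t1.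
Qed.

Lemma sum_split3 (F : K -> int) :
  \sum_c F c = F 0 + F 1 + F (-1) + \sum_(c | c \notin S3) F c.
Proof.
rewrite (bigID (mem S3)) /= -big_uniq ?uniq_S3 //=; congr (_ + _).
by rewrite !big_cons big_nil addr0 addrA.
Qed.

Lemma card_rest : \sum_(c : K | c \notin S3) (1 : int) = q - 3.
Proof.
have := sum_split3 (fun=> 1); rewrite sumr_const => E1.
have : q = 1 + 1 + 1 + \sum_(c : K | c \notin S3) (1 : int) by rewrite -E1 natz.
by move=> ->; ring.
Qed.

Lemma sum_rest_ns : \sum_(c | c \notin S3) (ns c)%:Z = q - T - 2 * nu%:Z.
Proof.
have := sum_split3 (fun c => (ns c)%:Z); rewrite ns0 ns1 => E1.
have : q = 0%:Z + (T + nu%:Z) + nu%:Z + \sum_(c | c \notin S3) (ns c)%:Z.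
  by rewrite -E1 -sum_ns; apply: (big_morph Posz PoszD).
by move=> ->; ring.
Qed.

Lemma sum_rest_ms : \sum_(c | c \notin S3) (1 - (ms c)%:Z) = 2 * nu%:Z.
Proof.
have := sum_split3 (fun c => (ms c)%:Z); rewrite ms0 ms1 msN1 => E1.
have : q = 1%:Z + nu.+1%:Z + nu.+1%:Z + \sum_(c | c \notin S3) (ms c)%:Z.
  by rewrite -E1 -sum_ms; apply: (big_morph Posz PoszD).
by rewrite big_split /= sumrN card_rest => ->; rewrite -addn1 PoszD; ring.
Qed.

(** Off [S3] the counts [ns] are even, so if none vanished they would add up to at least
    [2 (q - 3)]; but their sum is [q - (T + nu) - nu <= q], and [q > 6]. At a zero of [ns], [rel]
    becomes the hypothesis of [product_eq0]. *)
Lemma product0 : C * E = 0.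
Proof.
have e_gt0 : (0 < e)%N by case: e cardK q_gt6 => // ->.
have Dq : q = p%:Z ^+ e by rewrite cardK; clear; lia.
have /existsP[c /andP[cN /eqP n0]] : [exists c, (c \notin S3) && (ns c == 0%N)].
  apply: contraT; rewrite negb_exists => /forallP all2.
  have : \sum_(c : K | c \notin S3) 2 <= \sum_(c | c \notin S3) (ns c)%:Z.
    apply: ler_sum => c cN; have := all2 c; rewrite cN /=.
    move: cN; rewrite !inE !negb_or => /and3P[_ c1 cN1].
    by have := ns_even c1 cN1; case: (ns c) => [|[|k]].
  rewrite sum_rest_ns (eq_bigr (fun c => 2 * 1)) // -mulr_sumr card_rest.
  have : 0 <= T + nu%:Z by rewrite -ns1.
  by clear -q_gt6; lia.
have := rel cN; rewrite n0 mulr0 add0r Dq.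
apply: product_eq0 => //; rewrite -?Dq //.
by rewrite -cardK -sum_ms (bigD1 c) //= leq_addr.
Qed.

(** As [C E = 0], [D = C + E] is the nonzero one of the two and [rel] becomes
    [D ns(c) = (q - D) (1 - ms(c))]. A zero of [ms] gives [q = Q D]; then [sum_sq] expresses the
    second moment of [ns] by [nu], and the fourth moment of [W] yields an equation between powers of
    [p] with no solution. *)
Lemma transposition_arith : False.
Proof.
have CE0 := product0.
have q0 : 0 < q by clear -q_gt6; lia.
pose D := C + E.
have ThE : Theta = q * D by rewrite CE0 /D; ring.
have D0 : D != 0.
  apply: contra CE; rewrite /D addr_eq0 => /eqP EC.
  by move/eqP: CE0; rewrite EC mulNr oppr_eq0 mulf_eq0 orbb => /eqP->; rewrite oppr0.
(* Here and in [m2] and [m4], multiples of [C * E], which is 0, absorb the cross terms. *)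
have DD : D ^+ 2 = C ^+ 2 + E ^+ 2 by rewrite /D -[RHS]addr0 -[0](mulr0 2) -CE0; ring.
have m1 : x%:Z * C + y%:Z * E = q - N%:Z * T by rewrite -moment1; ring.
have m2 : 2 * D * (q - N%:Z * T) = q ^+ 2 - N%:Z * T ^+ 2.
  rewrite -m1 -moment2 (_ : _ - _ = 2 * x%:Z * C ^+ 2 + 2 * y%:Z * E ^+ 2); last by ring.
  by rewrite /D -[RHS]addr0 -[0](mulr0 (2 * (x%:Z + y%:Z))) -CE0; ring.
have m4 : x%:Z * C ^+ 4 + y%:Z * E ^+ 4 = (q - N%:Z * T) * D ^+ 3.
  rewrite -m1 /D -[LHS]addr0.
  rewrite -[0](mulr0 (3 * x%:Z * C ^+ 2 + 3 * x%:Z * C * E + x%:Z * E ^+ 2 +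
     (3 * y%:Z * E ^+ 2 + 3 * y%:Z * C * E + y%:Z * C ^+ 2))) -CE0; ring.
have T_lt : 2 * T ^+ 2 <= q ^+ 2.
  rewrite -moment2; have := sqr_ge0 C; have := sqr_ge0 E; have := sqr_ge0 T.
  by move: N_gt1; clear; move: (T ^+ 2) (C ^+ 2) (E ^+ 2) => u v w; nia.
have qT : 0 < q - T by move: T_lt q0; clear; nia.
have eq_nu : 2 * q * nu%:Z = D * (q - T).
  apply: (@mulfI _ q); first by rewrite gt_eqF.
  by move: rel1; rewrite ThE CE0 -/D; clear; lia.
have D_gt0 : 0 < D.
  have : 0 <= D * (q - T) by rewrite -eq_nu !mulr_ge0 // ltW.
  by rewrite pmulr_lge0 // le_eqVlt eq_sym (negPf D0).
have nu_gt0 : 0 < nu%:Z.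
  by have : 0 < 2 * q * nu%:Z; [rewrite eq_nu mulr_gt0 | rewrite pmulr_rgt0 // mulr_gt0].
have D_lt : 2 * D <= q by move: bound; rewrite -DD; clear -D_gt0 q0; nia.
have relD c : c \notin S3 -> D * (ns c)%:Z = (q - D) * (1 - (ms c)%:Z).
  move=> cN; apply: (@mulfI _ q); first by rewrite gt_eqF.
  by have := rel cN; rewrite ThE CE0; clear; lia.
(* The numbers [1 - ms(c)] add up to [2 nu > 0] off [S3], so one of them is positive. *)
have /existsP[c /andP[cN /eqP mc0]] : [exists c, (c \notin S3) && (ms c == 0%N)].
  apply: contraT; rewrite negb_exists => /forallP allm.
  have : \sum_(c | c \notin S3) (1 - (ms c)%:Z) <= 0.
    apply: sumr_le0 => c cN; have := allm c; rewrite cN /= subr_le0.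
    by case: (ms c).
  by rewrite sum_rest_ms; clear -nu_gt0; lia.
pose Q := (ns c)%:Z + 1.
have qE : q = Q * D by have := relD c cN; rewrite mc0 /Q; clear; lia.
have Q_gt1 : 1 < Q by move: D_lt; rewrite qE; clear -D_gt0; nia.
(* Since [ns(c') = (Q - 1) (1 - ms(c'))] is nonnegative, [ms(c')] is 0 or 1 and [1 - ms(c')] is its
   own square. *)
have nsE c' : c' \notin S3 -> (ns c')%:Z ^+ 2 = (Q - 1) ^+ 2 * (1 - (ms c')%:Z).
  move=> /relD; rewrite qE => r'.
  have {}r' : (ns c')%:Z = (Q - 1) * (1 - (ms c')%:Z).
    by apply: (@mulfI _ D); rewrite // r'; ring.
  have : 0 <= (Q - 1) * (1 - (ms c')%:Z) by rewrite -r'.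
  rewrite pmulr_rge0 ?subr_gt0 // subr_ge0 => m1'; rewrite r'.
  have [->|->] : ms c' = 0%N \/ ms c' = 1%N by clear -m1'; lia.
    by ring.
  by ring.
have sum_sq : \sum_c (ns c)%:Z ^+ 2 = 2 * nu%:Z * (Q - 1) ^+ 2 + (T + nu%:Z) ^+ 2 + nu%:Z ^+ 2.
  rewrite sum_split3 ns0 ns1 (eq_bigr _ nsE) -mulr_sumr sum_rest_ms; ring.
have DQ : exists2 b : nat, (0 < b)%N & Q = p%:Z ^+ b.
  have : (absz Q %| p ^ e)%N.
    by rewrite -cardK; apply/dvdnP; exists (absz D); move: qE; clear -D_gt0 Q_gt1; nia.
  move/(dvdn_pfactor _ _ p_pr) => [b _ Qb]; exists b; last by clear -Qb Q_gt1; lia.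
  by case: b Qb => //; clear -Q_gt1; lia.
have DD' : exists a : nat, D = p%:Z ^+ a.
  have : (absz D %| p ^ e)%N.
    by rewrite -cardK; apply/dvdnP; exists (absz Q); move: qE; clear -D_gt0 Q_gt1; nia.
  by move/(dvdn_pfactor _ _ p_pr) => [a _ Da]; exists a; clear -Da D_gt0; lia.
have DN : exists2 k : nat, (0 < k)%N & N%:Z = p%:Z ^+ k.
  have : (N %| p ^ (e * 2))%N.
    rewrite expnM -cardK; apply/dvdnP; exists (absz Dl).
    by move: NDl; clear -N_gt1 q0; nia.
  move/(dvdn_pfactor _ _ p_pr) => [k _ Nk]; exists k; last by clear -Nk; lia.
  by case: k Nk N_gt1 => // ->.
have [b b_gt0 Qb] := DQ; have [a Da] := DD'; have [k k_gt0 Nk] := DN.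
have Q_gt2 : 2 < Q.
  have : Q != 2.
    rewrite Qb; case: b b_gt0 {Qb} => // b _; apply/eqP=> p2.
    have : (p %| 2)%N by rewrite -[p]/(absz p%:Z) -(dvdzE _ 2) -p2 dvdz_exp.
    by move/dvdn_leq => /(_ isT); clear -p_gt4; lia.
  by clear -Q_gt1; lia.
have N_gt0 : 0 < N%:Z by clear -N_gt1; lia.
have eqT : 2 * Q * nu%:Z = Q * D - T.
  by apply: (@mulfI _ D); rewrite // -qE -eq_nu qE; ring.
have := @fourth_moment_arith N%:Z T D Q nu%:Z Dl D_gt0 Q_gt2 N_gt0 nu_gt0 eqT.
rewrite -qE NDl => /(_ erefl m2); rewrite -sum_sq moment4 m4 mulrA => /(_ erefl).
rewrite Nk Qb Da; apply/eqP; apply: prime_power_arith => //.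
by clear -p_gt4; lia.
Qed.

End TranspositionArith.

(** * Galois action on the Weil sums *)

Section GaloisAction.

Variables (K : finFieldType) (chi : K -> algC) (p n s g : nat).
Variable sg : {rmorphism algC -> algC}.
Hypotheses (chi0 : chi 0 = 1) (chiD : forall x y, chi (x + y) = chi x * chi y).
Hypothesis chi_nt : exists x, chi x != 1.
Hypotheses (pchK : p \in [pchar K]) (cardK : #|K| = (p ^ n)%N).
Hypotheses (s_gt0 : (0 < s)%N) (co_s : coprime s #|K|.-1).
Hypotheses (g_prim : (p.-1).-primitive_root (g%:R : K))
           (Dsg : forall x, sg (chi x) = chi (g%:R * x)).
Notation W := (weil chi s).
Notation q := (#|K|%:R : algC).

Lemma card_gt1 : (1 < #|K|)%N.
Proof. exact: finNzRing_gt1. Qed.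

Lemma card_exp_gt0 : (0 < n)%N.
Proof. by case: n cardK (finNzRing_gt1 K) => // ->. Qed.

Lemma dvdn_card : (p %| #|K|)%N.
Proof. by rewrite cardK dvdn_exp ?card_exp_gt0. Qed.

Lemma prim_neq0 : (g%:R : K) != 0.
Proof.
apply/eqP=> g0; have := prim_expr_order g_prim; rewrite g0 expr0n.
rewrite -subn1 subn_eq0 leqNgt prime_gt1 ?(pcharf_prime pchK) //=.
by move/esym/eqP; rewrite oner_eq0.
Qed.

(** Choose [e] with [e^s = g]; replacing [x] by [e x] shows that [h = g / e] works. Its [s]-th power
    determines it, the power map being injective. *)
Lemma galois_weil : exists2 h : K,
  h ^+ s = g%:R ^+ s.-1 & forall u, sg (W u) = W (h * u).
Proof.
have [t Dt] := power_map_root s_gt0 co_s.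
have g0 := prim_neq0.
pose e : K := g%:R ^+ t; have De : e ^+ s = g%:R by rewrite -exprM mulnC Dt.
have e0 : e != 0 by rewrite expf_neq0.
exists (g%:R / e) => [|u].
  by rewrite expr_div_n De -{1}(prednK s_gt0) exprSr mulfK.
rewrite rmorph_sum [RHS](reindex_inj (mulfI e0)) /=; apply: eq_bigr => x _.
by rewrite Dsg exprMn De; congr chi; field.
Qed.

Lemma weil_seq u : W u = \sum_(y <- [seq x ^+ s - u * x | x <- enum K]) chi y.
Proof. by rewrite big_map big_enum. Qed.

(** Such a sum has a multiple of [q] character terms, so the congruence in [chi_sum_int] becomes
    divisibility by [p]. *)
Lemma weil_sum_int (us : seq K) :
  let S := \sum_(u <- us) W u in sg S = S ->
  exists2 z : int, S = z%:~R & (p%:Z %| z)%Z.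
Proof.
pose r := flatten [seq [seq x ^+ s - u * x | x <- enum K] | u <- us].
have -> /= : \sum_(u <- us) W u = \sum_(y <- r) chi y.
  by rewrite big_flatten big_map; apply: eq_bigr => u _; exact: weil_seq.
case/(chi_sum_int chi0 chiD pchK g_prim Dsg) => z -> dv; exists z => //.
rewrite -(rpredBr _ (_ : (size r)%:Z \in dvdz p)) //.
rewrite dvdzE size_flatten /shape -map_comp sumnE big_map.
by apply: dvdn_sum => u _ /=; rewrite size_map -cardE dvdn_card.
Qed.

Lemma weil_mul_int u v : sg (W u * W v) = W u * W v ->
  exists2 z : int, W u * W v = z%:~R & (p%:Z %| z)%Z.
Proof.
pose r w := [seq x ^+ s - w * x | x <- enum K].
have -> : W u * W v = \sum_(y <- [seq x + y | x <- r u, y <- r v]) chi y.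
  rewrite big_allpairs_dep !weil_seq mulr_suml; apply: eq_bigr => x _.
  by rewrite mulr_sumr; apply: eq_bigr => y _; rewrite chiD.
case/(chi_sum_int chi0 chiD pchK g_prim Dsg) => z -> dv; exists z => //.
rewrite -(rpredBr _ (_ : (size [seq x + y | x <- r u, y <- r v])%:Z \in dvdz p)) //.
by rewrite dvdzE size_allpairs size_map -cardE dvdn_mulr ?dvdn_card.
Qed.

Lemma weil_int u : sg (W u) = W u -> exists2 z : int, W u = z%:~R & (p%:Z %| z)%Z.
Proof. by have := @weil_sum_int [:: u]; rewrite /= big_seq1. Qed.

Lemma weil_real u : odd s -> W u \is Num.real.
Proof.
move=> odd_s; rewrite CrealE /weil rmorph_sum [X in _ == X](reindex_inj (@oppr_inj _)) /=.
apply/eqP/eq_bigr => x _; rewrite -(chiN_conj chi0 chiD pchK); congr chi.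
by rewrite exprN_odd //; ring.
Qed.

Variable h : K.
Hypotheses (h_s : h ^+ s = g%:R ^+ s.-1) (Dh : forall u, sg (W u) = W (h * u)).

Lemma iter_galois_weil i u : iter i sg (W u) = W (h ^+ i * u).
Proof.
by elim: i => [|i IHi]; rewrite ?mul1r // iterS IHi Dh mulrA exprS.
Qed.

Lemma galois_neq0 : h != 0.
Proof.
apply/eqP=> h0; move/eqP: h_s; rewrite h0 expr0n gtn_eqF // eq_sym.
by rewrite expf_eq0 (negPf prim_neq0) andbF.
Qed.

Hypothesis h_neq1 : h != 1.

Lemma odd_prime : odd p.
Proof.
have p_pr := pcharf_prime pchK; rewrite -[odd p]negbK; apply: contra h_neq1 => p2.
have Dp : p = 2%N by case: (even_prime p_pr) => // op; rewrite op in p2.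
have g1 : (g%:R : K) = 1 by have := prim_expr_order g_prim; rewrite Dp.
by rewrite -(power_map_eq1 s_gt0 co_s) h_s g1 expr1n.
Qed.

Lemma odd_exponent : odd s.
Proof.
have := co_s; rewrite -[odd s]negbK; apply: contraL => s2.
have q2 : (2 %| #|K|.-1)%N.
  rewrite dvdn2; have : odd #|K| by rewrite cardK oddX odd_prime orbT.
  by case: #|K| => //= k; rewrite negbK.
have : (2 %| gcdn s #|K|.-1)%N by rewrite dvdn_gcd q2 dvdn2 s2.
by apply: contraL => /eqP->.
Qed.

(** For [p = 3], [g^2 = 1] and [s - 1] is even, so [h^s = 1] and [h = 1]. *)
Lemma prime_ge5 : (4 < p)%N.
Proof.
have p_pr := pcharf_prime pchK; have odd_p := odd_prime.
suff : p != 3 by case: p p_pr odd_p => [|[|[|[|[]]]]].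
apply: contra h_neq1 => /eqP p3; rewrite -(power_map_eq1 s_gt0 co_s) h_s.
have g2 : (g%:R : K) ^+ 2 = 1 by have := prim_expr_order g_prim; rewrite p3.
have -> : s.-1 = (2 * s./2)%N.
  by rewrite -[s in LHS]odd_double_half odd_exponent -muln2 mulnC.
by rewrite exprM g2 expr1n.
Qed.

Lemma natr_neq0 k : (0 < k < p)%N -> (k%:R : K) != 0.
Proof. by move=> kp; rewrite -(dvdn_pcharf pchK) gtnNdvd; lia. Qed.

(** The hypothesis says that [W] is invariant under scaling by [h^i], so [weil_ext] applies. *)
Lemma galois_order i : (forall u, u != 0 -> iter i sg (W u) = W u) -> h ^+ i = 1.
Proof.
move=> fixW; apply: (weil_ext chi0 chiD chi_nt s_gt0 co_s odd_exponent) => [w|].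
  rewrite mul1r -iter_galois_weil; have [->|/fixW //] := eqVneq w 0.
  by rewrite iter_galois_weil mulr0.
exact: oner_neq0.
Qed.

(** * Traces of the Weil sums and their first two moments *)

Section RaySum.

Variables (m : nat) (r : K -> int).
Hypotheses (h_prim : m.-primitive_root h)
           (Dr : forall u, (r u)%:~R = \sum_(i < m) W (h ^+ i * u)).

Lemma sum_weil_scale (a : K) : a != 0 -> \sum_u W (a * u) = q.
Proof.
move=> a0; rewrite -(sum_weil chi0 chiD chi_nt s_gt0 (s := s)).
by rewrite [RHS](reindex_inj (mulfI a0)).
Qed.

Lemma ray_sum0 : r 0 = 0.
Proof.
apply: (@intr_inj algC); rewrite Dr big1 // => i _.
by rewrite mulr0 (weil0 chi0 chiD chi_nt s_gt0 co_s).
Qed.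

Lemma ray_sum_galois u : r (h * u) = r u.
Proof.
apply: (@intr_inj algC); rewrite !Dr; have m_gt0 := prim_order_gt0 h_prim.
case: m h_prim m_gt0 => // k k_prim _; rewrite big_ord_recr [RHS]big_ord_recl /=.
rewrite addrC mulrA -exprSr (prim_expr_order k_prim) mul1r; congr (_ + _).
by apply: eq_bigr => i _; rewrite mulrA -exprSr.
Qed.

Lemma sum_ray_sum : \sum_u r u = m%:Z * #|K|%:Z.
Proof.
apply: (@intr_inj algC); rewrite rmorph_sum /= (eq_bigr _ (fun u _ => Dr u)).
rewrite exchange_big /= (eq_bigr (fun=> q)) => [|i _].
  by rewrite sumr_const card_ord -[LHS]mulr_natl rmorphM /= -!pmulrn.
by rewrite sum_weil_scale ?expf_neq0 ?galois_neq0.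
Qed.

(** Distinct powers of [h] give orthogonal scalings of [W], so only the [m] diagonal terms
    contribute. *)
Lemma sum_ray_sum2 : \sum_u r u ^+ 2 = m%:Z * #|K|%:Z ^+ 2.
Proof.
apply: (@intr_inj algC); rewrite rmorph_sum /=.
under eq_bigr => u _ do rewrite rmorphXn /= Dr expr2 mulr_suml.
rewrite exchange_big /= (eq_bigr (fun=> q ^+ 2)) => [|i _].
  by rewrite sumr_const card_ord -[LHS]mulr_natl rmorphM rmorphXn /= -!pmulrn.
under eq_bigr => u _ do rewrite mulr_sumr.
have hi0 := expf_neq0 i galois_neq0.
rewrite exchange_big (bigD1 i) //= [X in _ + X]big1 => [|j ji].
  rewrite addr0 -(sum_weil2 chi0 chiD chi_nt s_gt0 co_s odd_exponent).
  by rewrite [RHS](reindex_inj (mulfI hi0)); apply: eq_bigr => u _; rewrite expr2.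
transitivity (\sum_u W u * W (h ^+ j / h ^+ i * u)).
  rewrite [RHS](reindex_inj (mulfI hi0)); apply: eq_bigr => u _ /=.
  by rewrite mulrA divfK.
rewrite (sum_weil_mul chi0 chiD chi_nt s_gt0 co_s odd_exponent).
rewrite -(inj_eq (mulIf hi0)) divfK // mul1r (eq_prim_root_expr h_prim).
by rewrite !modn_small // val_eqE (negPf ji) mulr0.
Qed.

End RaySum.

Definition weil_values (vs : seq algC) :=
  [/\ uniq vs, forall u, u != 0 -> W u \in vs &
      forall v, v \in vs -> exists2 u, u != 0 & W u = v].

Lemma ray_sum_int m : m.-primitive_root h ->
  exists r : K -> int, forall u, (r u)%:~R = \sum_(i < m) W (h ^+ i * u).
Proof.
move=> h_prim; apply: (fin_all_exists (P := fun u z => z%:~R = _)) => u.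
pose us := [seq h ^+ i * u | i : 'I_m <- index_enum 'I_m].
have DS : \sum_(i < m) W (h ^+ i * u) = \sum_(v <- us) W v by rewrite big_map.
have [|z Dz _] := @weil_sum_int us; last by exists z; rewrite -Dz DS.
rewrite -DS rmorph_sum /=; have m_gt0 := prim_order_gt0 h_prim.
case: m h_prim m_gt0 {us DS} => // k k_prim _; rewrite big_ord_recr [RHS]big_ord_recl /=.
rewrite addrC Dh mulrA -exprS (prim_expr_order k_prim); congr (_ + _).
by apply: eq_bigr => i _; rewrite Dh mulrA -exprS.
Qed.

(** * Exclusion of the cycle types *)

Section Cycles.

Variables a b c d : algC.
Hypothesis vals : weil_values [:: a; b; c; d].

Lemma weil_val u : u != 0 -> [\/ W u = a, W u = b, W u = c | W u = d].
Proof.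
case: vals => _ vP _ /vP; rewrite !inE => /or4P[]/eqP ->;
  [exact: Or41|exact: Or42|exact: Or43|exact: Or44].
Qed.

Lemma weil_val_ex : [/\ exists2 u, u != 0 & W u = a, exists2 u, u != 0 & W u = b,
  exists2 u, u != 0 & W u = c & exists2 u, u != 0 & W u = d].
Proof. by case: vals => _ _ ex; split; apply: ex; rewrite !inE eqxx ?orbT. Qed.

Lemma four_le_card : (4 < #|K|)%N.
Proof.
have [U _ ex] := vals.
have : {subset [:: a; b; c; d] <= [seq W u | u <- enum (predC1 (0 : K))]}.
  by move=> v /ex[u u0 <-]; rewrite map_f // mem_enum.
move/(uniq_leq_size U); rewrite size_map -cardE cardC1 => le4.
by rewrite -(prednK (ltnW (finNzRing_gt1 K))).
Qed.

Lemma card_ge7 : #|K| != 5%N -> (6 < #|K|)%N.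
Proof.
move=> qn5; have q4 := four_le_card; have odd_q : odd #|K|.
  by rewrite cardK oddX odd_prime orbT.
by move: #|K| qn5 q4 odd_q => [|[|[|[|[|[|[|k]]]]]]].
Qed.

Lemma no_four_cycle : sg a = b -> sg b = c -> sg c = d -> sg d = a -> #|K| = 5%N.
Proof.
move=> sa sb sc sd.
have DT u : u != 0 -> \sum_(i < 4) W (h ^+ i * u) = a + b + c + d.
  move=> u0; rewrite (eq_bigr (fun i : 'I_4 => iter i sg (W u))) => [|i _].
    rewrite !big_ord_recl big_ord0 /=.
    by case: (weil_val u0) => ->; rewrite ?(sa, sb, sc, sd); ring.
  by rewrite iter_galois_weil.
have [[u u0 Du] _ _ _] := weil_val_ex.
have [|T DTz _] := @weil_sum_int [seq h ^+ i * u | i : 'I_4 <- index_enum 'I_4].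
  by rewrite big_map DT // !rmorphD sa sb sc sd /=; ring.
rewrite big_map DT // in DTz.
have eqT : (#|K|%:Z - 1) * T = 4 * #|K|%:Z.
  apply: (@intr_inj algC); rewrite !rmorphM rmorphB /= -!pmulrn -DTz.
  transitivity (\sum_u \sum_(i < 4) W (h ^+ i * u)).
    rewrite (bigD1 0) //= [X in _ = X + _]big1 ?add0r => [|i _]; last first.
      by rewrite mulr0 (weil0 chi0 chiD chi_nt s_gt0 co_s).
    rewrite (eq_bigr (fun=> a + b + c + d)) => [|v v0]; last by rewrite DT.
    rewrite sumr_const -[RHS]mulr_natl cardC1; congr (_ * _).
    by rewrite -subn1 natrB // ltnW ?finNzRing_gt1.
  rewrite exchange_big /= (eq_bigr (fun=> q)) => [|i _].
    by rewrite sumr_const card_ord -[LHS]mulr_natl.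
  by rewrite sum_weil_scale ?expf_neq0 ?galois_neq0.
have : (#|K|.-1 %| 4)%N.
  have -> : #|K|.-1 = absz (#|K|%:Z - 1) by have := card_gt1; lia.
  (* From [(q - 1) T = 4 q] one gets [(q - 1) (T - 4) = 4]. *)
  rewrite -(dvdzE _ 4); apply/dvdzP; exists (T - 4).
  by move: eqT; lia.
by move/dvdn_leq => /(_ isT); have := four_le_card; lia.
Qed.

Lemma no_three_cycle : #|K| != 5%N ->
  sg a = b -> sg b = c -> sg c = a -> sg d = d -> False.
Proof.
move=> qn5 sa sb sc sd; have q7 := card_ge7 qn5.
have [U _ _] := vals; move: U.
rewrite /= !inE !negb_or -!andbA => /and5P[ab ac ad bc /and3P[bd cd _]].
have p_pr := pcharf_prime pchK; have p5 := prime_ge5.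
have h3 : h ^+ 3 = 1.
  by apply: galois_order => u /weil_val[] -> /=; rewrite ?(sa, sb, sc, sd).
have h_prim := prim_root_prime (isT : prime 3) h3 h_neq1.
have [r Dr] := ray_sum_int h_prim.
have Dr' u : (r u)%:~R = W u + sg (W u) + sg (sg (W u)).
  rewrite Dr !big_ord_recl big_ord0 addr0 addrA; congr (_ + _ + _).
  - by rewrite mul1r.
  - by rewrite Dh.
  by rewrite !Dh mulrA.
have [[ua ua0 Da] _ _ [ud ud0 Dd]] := weil_val_ex.
have [D DD _] : exists2 z : int, W ud = z%:~R & (p%:Z %| z)%Z.
  by apply: weil_int; rewrite Dd.
have rval u : u != 0 -> r u = r ua /\ W u != d \/ r u = 3 * D /\ W u = d.
  move=> u0; case: (weil_val u0) => Du; [left|left|left|right]; split; rewrite ?Du //.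
  - by apply: (@intr_inj algC); rewrite !Dr' Du Da.
  - by apply: (@intr_inj algC); rewrite !Dr' Du Da sb sc sa sb; ring.
  - by apply: (@intr_inj algC); rewrite !Dr' Du Da sc sa sb; ring.
  by apply: (@intr_inj algC); rewrite Dr' Du !sd rmorphM /= -DD Dd; ring.
have rud : r ud = 3 * D by case: (rval ud ud0) => -[] //; rewrite Dd eqxx.
have [||||||||PQ [u0 u00 Du0]] := @two_valued_spike K p n 3 h r (r ua) (3 * D) p_pr p5 cardK isT _ h_prim.
- exact: leq_trans q7.
- exact: ray_sum0.
- by move=> u; apply: (ray_sum_galois h_prim Dr).
- exact: (sum_ray_sum (m := 3)).
- exact: sum_ray_sum2.
- by move=> u /rval[[]|[]]; [left|right].
- by exists ua.
- by exists ud.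
have [D0 rua] : D = 0 /\ r ua = #|K|%:Z.
  case: PQ => -[rua Dq]; last by split; [clear -Dq; lia | exact: rua].
  have : (3 %| p ^ n)%N.
    by rewrite -cardK; apply/dvdnP; exists (absz D); clear -Dq; lia.
  by rewrite Euclid_dvdX // => /andP[]; rewrite dvdn_prime2 //; clear -p5; lia.
have d0 : d = 0 by rewrite -Dd DD D0.
have Wout u : u \notin ray 3 h u0 -> W u = 0.
  move=> uN; have [->|u_neq0] := eqVneq u 0.
    exact: (weil0 chi0 chiD chi_nt s_gt0 co_s).
  case: (rval u u_neq0) => -[ru Wu]; last by rewrite Wu.
  by have := Du0 u; rewrite (negPf uN) ru rua; have := card_gt1; clear; lia.
have Win u : u \in ray 3 h u0 -> W u != 0.
  move=> uin; have := Du0 u; rewrite uin => ru; apply/eqP=> W0.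
  have := Dr' u; rewrite W0 !rmorph0 !addr0 ru => /eqP.
  by rewrite intr_eq0; have := card_gt1; clear; lia.
have in_ray x : (x * u0 \in ray 3 h u0) = [|| x == 1, x == h | x == h ^+ 2].
  apply/imsetP/or3P=> [[i _ /(mulIf u00)->]|].
    by case: i => [[|[|[|]]] //= _]; [exact: Or31|exact: Or32|exact: Or33].
  case=> /eqP->; [exists ord0|exists (@Ordinal 3 1 isT)|exists (@Ordinal 3 2 isT)] => //=.
have hh : h ^+ 2 + h + 1 = 0.
  apply: (mulfI (_ : h - 1 != 0)); first by rewrite subr_eq0.
  by rewrite mulr0; transitivity (h ^+ 3 - 1); [ring | rewrite h3 subrr].
have h2 : h ^+ 2 = - h - 1 by apply/eqP; rewrite -subr_eq0 -hh; apply/eqP; ring.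
have n3 : (3%:R : K) != 0 by apply: natr_neq0; clear -p5; lia.
have n2 : (2%:R : K) != 0 by apply: natr_neq0; clear -p5; lia.
have hm1 : h - 1 != 0 by rewrite subr_eq0.
(* At lag [(h - 1) u0] only the term [W u0 * W (h * u0)] survives. *)
have hm0 : (h - 1) * u0 != 0 by rewrite mulf_neq0.
have := sum_weil_shift chi0 chiD chi_nt odd_exponent hm0.
rewrite (bigD1 u0) //= big1 => [|u u_neq].
  rewrite addr0 (_ : u0 + (h - 1) * u0 = h * u0); last by ring.
  apply/eqP; rewrite mulf_neq0 ?Win //.
    by rewrite -[X in X \in _]mul1r in_ray eqxx.
  by rewrite in_ray eqxx orbT.
have [uin|/Wout->] := boolP (u \in ray 3 h u0); last by rewrite mul0r.
have {uin} : u = h * u0 \/ u = h ^+ 2 * u0.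
  move: uin u_neq; rewrite -[u](divfK u00) in_ray => /or3P[]/eqP-> ; [|by left|by right].
  by rewrite mul1r eqxx.
(* The shifted points are [(2 h - 1) u0] and [- 2 u0]. Either one lying on the ray would force
   [h = 1] or [3 = 0], by [h^2 + h + 1 = 0]. *)
case=> ->; rewrite [X in _ * X]Wout ?mulr0 //.
  rewrite (_ : h * u0 + _ = (2%:R * h - 1) * u0); last by ring.
  rewrite in_ray; apply/or3P; case=> /eqP E.
  - have := mulf_neq0 n2 hm1; rewrite (_ : 2%:R * (h - 1) = 2%:R * h - 1 - 1); last by ring.
    by rewrite E subrr eqxx.
  - case/negP: hm1; rewrite (_ : h - 1 = (2%:R * h - 1) - h); last by ring.
    by rewrite E subrr.
  have := mulf_neq0 hm1 hm1; rewrite (_ : (h - 1) * (h - 1) = h ^+ 2 - (2%:R * h - 1)); last by ring.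
  by rewrite E subrr eqxx.
rewrite (_ : h ^+ 2 * u0 + _ = - 2%:R * u0); last by rewrite h2; ring.
rewrite in_ray; apply/or3P; case=> /eqP E.
- case/negP: n3; rewrite (_ : 3%:R = 1 - (- 2%:R) :> K); last by ring.
  by rewrite E subrr.
- case/negP: n3; rewrite (_ : 3%:R = (- 2%:R) ^+ 2 + (- 2%:R) + 1 :> K); last by ring.
  by rewrite E hh.
case/negP: hm1; rewrite (_ : h - 1 = (h ^+ 2 + h + 1) - h ^+ 2 - 2%:R); last by ring.
by rewrite hh -E; apply/eqP; ring.
Qed.

(* Otherwise the line [v + F_p u0] avoids [0], [u0] and [- u0], and [W] sums to [0]
   on it because [chi (x^s) = 1] wherever [chi (u0 x) = 1]; but an odd number of
   terms [+B] or [-B] cannot cancel. *)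
Lemma antisymmetric_weil_line (u0 v : K) (B : algC) : h = -1 -> u0 != 0 -> B != 0 ->
  (forall u, W u + W (- u) = q * ((u == u0)%:R + (u == - u0)%:R)) ->
  (forall u, u != 0 -> u != u0 -> u != - u0 -> W u = B \/ W u = - B) ->
  exists k : 'I_p, v = k%:R * u0.
Proof.
move=> hN1 u00 B0 Wsym WB.
have [/existsP[k /eqP ->]|] := boolP [exists k : 'I_p, v == k%:R * u0]; first by exists k.
rewrite negb_exists => /forallP vN; exfalso.
have p_pr := pcharf_prime pchK; have p_gt0 := prime_gt0 p_pr.
have {}vN k : v != k%:R * u0.
  apply: contra (vN (Ordinal (ltn_pmod k p_gt0))) => /eqP {1}->; apply/eqP; congr (_ * _).
  by rewrite /= {1}(divn_eq k p) natrD natrM (pcharf0 pchK) mulr0 add0r.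
(* Multiplication by [p - 1] represents [- k] by a natural number, as [vN] requires. *)
have natN k : ((k * p.-1)%:R : K) = - k%:R.
  apply/eqP; rewrite -addr_eq0 -natrD -mulnSr prednK // natrM (pcharf0 pchK) mulr0 //.
have v_off (k : nat) (y : K) : v + k%:R * u0 = y -> v = y + (k * p.-1)%:R * u0.
  by move=> <-; rewrite natN; ring.
(* The transform of [W u + W (- u)] at [x] gives [chi (x^s) + chi (- x^s) = chi (u0 x) + chi (- u0
   x) = 2]; a number whose sum with its inverse is 2 equals 1. *)
have chi_s x : chi (u0 * x) = 1 -> chi (x ^+ s) = 1.
  move=> cx1; have cN z : chi (- z) * chi z = 1 by apply: chiNM.
  have : chi (x ^+ s) + chi (- x ^+ s) = 2.
    apply: (mulfI (card_neq0 K)); rewrite mulrDr.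
    have -> : q * chi (x ^+ s) = \sum_u W u * chi (u * x) by rewrite sum_weil_chi.
    have -> : q * chi (- x ^+ s) = \sum_u W (- u) * chi (u * x).
      rewrite -exprN_odd ?odd_exponent // -(sum_weil_chi chi0 chiD chi_nt).
      by rewrite [RHS](reindex_inj (@oppr_inj _)); apply: eq_bigr => u _; rewrite opprK mulNr mulrN.
    rewrite -big_split /= (eq_bigr (fun u => q * ((u == u0)%:R * chi (u * x) + (u == - u0)%:R * chi (u * x)))).
      rewrite -mulr_sumr big_split /=; congr (_ * _).
      have pick w : \sum_u (u == w)%:R * chi (u * x) = chi (w * x).
        rewrite (bigD1 w) //= eqxx mul1r big1 ?addr0 // => u /negPf->.
        by rewrite mul0r.
      rewrite !pick mulNr cx1; have := cN (u0 * x); rewrite cx1 mulr1 => ->.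
      by rewrite -[2]/(1 + 1).
    by move=> u _; rewrite -mulrDl Wsym; ring.
  move=> sum2; apply/eqP; rewrite -subr_eq0.
  suff /eqP : (chi (x ^+ s) - 1) ^+ 2 = 0 by rewrite expf_eq0.
  have -> : (chi (x ^+ s) - 1) ^+ 2 = chi (x ^+ s) ^+ 2 - chi (x ^+ s) * 2 + 1 by ring.
  by rewrite -sum2 -(cN (x ^+ s)); ring.
have chiX w x k : chi (w - k%:R * u0 * x) = chi w * chi (- (u0 * x)) ^+ k.
  by rewrite -(chiMn chi0 chiD) -chiD; congr chi; rewrite -mulr_natl; ring.
(* Summing over [k] keeps only the [x] with [chi (u0 x) = 1], where [chi (x^s) = 1]. Dropping [x^s]
   therefore changes nothing, and the linear sums vanish because the line avoids 0. *)
have line0 : \sum_(k < p) W (v + k%:R * u0) = 0.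
  transitivity (\sum_(k < p) \sum_x chi (- (v + k%:R * u0) * x)); last first.
    rewrite big1 // => k _; rewrite sum_chi // oppr_eq0.
    have [|_] := eqVneq (v + k%:R * u0) 0; last by rewrite mulr0.
    by move/v_off; rewrite add0r => E; have := vN (k * p.-1)%N; rewrite {1}E eqxx.
  rewrite exchange_big [RHS]exchange_big /=; apply: eq_bigr => x _.
  transitivity (chi (x ^+ s - v * x) * \sum_(k < p) chi (- (u0 * x)) ^+ k).
    by rewrite mulr_sumr; apply: eq_bigr => k _; rewrite -chiX; congr chi; ring.
  transitivity (chi (- v * x) * \sum_(k < p) chi (- (u0 * x)) ^+ k); last first.
    by rewrite mulr_sumr; apply: eq_bigr => k _; rewrite -chiX; congr chi; ring.
  rewrite (sum_unity_powers (chi_unity chi0 chiD pchK _)).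
  have [c1|_] := eqVneq (chi (- (u0 * x))) 1; last by rewrite !mulr0.
  have cx1 : chi (u0 * x) = 1 by have := chiNM chi0 chiD (u0 * x); rewrite c1 mul1r.
  by rewrite chiD (chi_s x cx1) mul1r mulNr.
pose e (k : 'I_p) := W (v + k%:R * u0) != B.
have We (k : 'I_p) : W (v + k%:R * u0) = B - 2 * B * (e k)%:R.
  rewrite /e; have [->|nB] := eqVneq (W _) B; first by rewrite mulr0 subr0.
  have [] := WB (v + k%:R * u0).
  - apply/eqP=> /v_off; rewrite add0r => E.
    by have := vN (k * p.-1)%N; rewrite {1}E eqxx.
  - apply/eqP=> /v_off E; have := vN (k * p.-1).+1.
    by rewrite -natr1 mulrDl mul1r addrC {1}E eqxx.
  - apply/eqP=> /v_off E; have := vN ((k.+1) * p.-1)%N.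
    rewrite {1}E !natN -natr1; case/eqP; ring.
  - by move=> E; rewrite E eqxx in nB.
  by move=> ->; rewrite mulr1; ring.
move: line0; rewrite (eq_bigr _ (fun k _ => We k)) big_split /= sumr_const card_ord.
rewrite sumrN -mulr_sumr -natr_sum -[B *+ p]mulr_natl => /eqP.
rewrite (_ : _ - _ = B * (p%:R - 2 * (\sum_k e k)%:R)); last by ring.
rewrite mulf_eq0 (negPf B0) subr_eq0 -natrM eqr_nat => /eqP pE.
by have := odd_prime; rewrite pE oddM.
Qed.

(** By [antisymmetric_weil_line], [K] is the line through [u0], so [q = p]. With [X = W u0] and
    [Y = W (- u0)], [X + Y = q] and the correlation at [-1] gives [2 X Y = (q - 3) B^2], so
    [0 <= (X - Y)^2 = q^2 - 2 (q - 3) B^2]. Since [B^2] is a positive multiple of [p], this forces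
    [p <= 6]. *)
Lemma no_antisymmetric_weil (u0 : K) (B : algC) : (6 < #|K|)%N ->
  h = -1 -> u0 != 0 -> B != 0 -> sg B = - B ->
  (forall u, W u + W (- u) = q * ((u == u0)%:R + (u == - u0)%:R)) ->
  (forall u, u != 0 -> u != u0 -> u != - u0 -> W u = B \/ W u = - B) -> False.
Proof.
move=> q7 hN1 u00 B0 sB Wsym WB.
have p_pr := pcharf_prime pchK; have p_gt0 := prime_gt0 p_pr.
have odd_s := odd_exponent.
have two0 : (2%:R : K) != 0 by apply: natr_neq0; have := prime_ge5; clear; lia.
have u0N : - u0 != u0.
  apply: contraNneq two0 => E; rewrite -(mulIr_eq0 _ (mulIf u00)).
  by rewrite mulr_natl mulr2n -{1}E addNr.
have Kp : #|K| = p.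
  apply/eqP; rewrite eqn_leq [X in _ && X]dvdn_leq ?dvdn_card ?(ltnW card_gt1) // andbT.
  rewrite -(cardsT K) -[X in (_ <= X)%N](card_ord p) -cardsT.
  apply: leq_trans (leq_imset_card (fun k : 'I_p => (k%:R : K) * u0) _).
  apply/subset_leq_card/subsetP=> v _; have [k ->] := antisymmetric_weil_line v hN1 u00 B0 Wsym WB.
  by apply/imsetP; exists k.
have W0 : W 0 = 0 by apply: weil0.
have WN u : sg (W u) = W (- u) by rewrite Dh hN1 mulN1r.
pose X := W u0; pose Y := W (- u0).
have XY : X + Y = q by rewrite /X /Y Wsym eqxx eq_sym (negPf u0N) addr0 mulr1.
have in_rest (u : K) : u \notin [set 0; u0; - u0] -> W u * W (- u) = - B ^+ 2.
  rewrite !inE !negb_or -andbA => /and3P[n0 n1 n2].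
  have /eqP := Wsym u; rewrite (negPf n1) (negPf n2) addr0 mulr0 addr_eq0 => /eqP WNu.
  by rewrite -[W (- u)]opprK -WNu; case: (WB u n0 n1 n2) => ->; ring.
have [z1 z2 z3] : [/\ 0 == u0 = false, 0 == - u0 = false & u0 == - u0 = false].
  by rewrite eq_sym (eq_sym 0) oppr_eq0 (negPf u00) eq_sym (negPf u0N).
have card3 : #|[set 0; u0; - u0]| = 3.
  by rewrite -setUA !cardsU1 cards1 !inE z1 z2 z3.
have XYB : 2 * (X * Y) = (q - 3) * B ^+ 2.
  have := sum_weil_mul chi0 chiD chi_nt s_gt0 co_s odd_s (-1).
  have -> : (-1 == 1 :> K) = false.
    by apply/negbTE; apply: contra two0; rewrite eq_sym -subr_eq0 opprK.
  rewrite mulr0 (bigID (mem [set 0; u0; - u0])) /= addrC => /eqP.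
  rewrite addr_eq0 => /eqP E; apply/esym; move: E.
  rewrite (eq_bigr (fun=> - B ^+ 2)) => [|u]; last by rewrite mulN1r; apply: in_rest.
  rewrite sumr_const -[LHS]mulr_natl (eq_card (B := ~: [set 0; u0; - u0])) => [|u]; last first.
    by rewrite inE.
  rewrite cardsCs setCK card3 natrB ?(leq_trans _ q7) // mulrN => /oppr_inj->.
  rewrite -setUA !big_setU1 ?inE ?z1 ?z2 ?z3 //= big_set1.
  by rewrite W0 mul0r add0r !mulN1r opprK /X /Y; ring.
have /subsetPn[v _ v_rest] : ~~ ([set: K] \subset [set 0; u0; - u0]).
  by apply/negP=> /subset_leq_card; rewrite cardsT card3 leqNgt (leq_trans _ q7).
have [z Dz dv_z] : exists2 z : int, W v * W (- v) = z%:~R & (p%:Z %| z)%Z.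
  by apply: weil_mul_int; rewrite rmorphM !WN opprK mulrC.
move: (Dz); rewrite in_rest // => DB.
have sqr_real (x : algC) : x \is Num.real -> x ^+ 2 = `|x| ^+ 2 by move/real_normK.
have Breal : B \is Num.real.
  move: v_rest; rewrite !inE !negb_or -andbA => /and3P[n0 n1 n2].
  have Wr := weil_real v odd_s; case: (WB v n0 n1 n2) => E; first by rewrite -E.
  by rewrite -rpredN -E.
have z_lt0 : z < 0.
  by rewrite -(ltrz0 algC) -DB oppr_lt0 (sqr_real _ Breal) exprn_gt0 ?normr_gt0.
have : 0 <= #|K|%:Z ^+ 2 + 2 * (#|K|%:Z - 3) * z.
  rewrite -(ler0z algC) rmorphD rmorphXn /= !rmorphM rmorphB /= -!pmulrn -DB.
  have -> : q ^+ 2 + 2 * (q - 3) * - B ^+ 2 = (X - Y) ^+ 2.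
    transitivity (q ^+ 2 - 2 * ((q - 3) * B ^+ 2)); first by ring.
    by rewrite -XYB -XY; ring.
  by rewrite sqr_real ?rpredB ?weil_real // exprn_ge0 ?normr_ge0.
have [y Dy] := dvdzP dv_z; rewrite Dy Kp in z_lt0 *; move: q7; rewrite Kp.
move: z_lt0; rewrite pmulr_llt0 ?ltz_nat // => y_lt0 p7.
have -> : p%:Z ^+ 2 + 2 * (p%:Z - 3) * (y * p%:Z) = p%:Z * (p%:Z + 2 * (p%:Z - 3) * y) by ring.
rewrite pmulr_rge0 ?ltz_nat //.
by have : (p%:Z - 3) * y <= - (p%:Z - 3); clear -y_lt0 p7; nia.
Qed.

(** The traces [a + b] and [c + d] are 0 and [q] in some order; the pair with trace 0 is [B], [- B]
    and is taken everywhere off 0, [u0] and [- u0]. *)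
Lemma no_two_two : #|K| != 5%N ->
  sg a = b -> sg b = a -> sg c = d -> sg d = c -> False.
Proof.
move=> qn5 sa sb sc sd; have q7 := card_ge7 qn5.
have [U _ _] := vals; move: U.
rewrite /= !inE !negb_or -!andbA => /and5P[ab ac ad bc /and3P[bd cd _]].
have p_pr := pcharf_prime pchK; have p5 := prime_ge5.
have h2 : h ^+ 2 = 1.
  by apply: galois_order => u /weil_val[] -> /=; rewrite ?(sa, sb, sc, sd).
have hN1 : h = -1 by move/eqP: h2; rewrite sqrf_eq1 (negPf h_neq1) => /eqP.
have h_prim := prim_root_prime (isT : prime 2) h2 h_neq1.
have [r Dr] := ray_sum_int h_prim.
have Dr' u : (r u)%:~R = W u + W (- u).
  by rewrite Dr !big_ord_recl big_ord0 addr0 mul1r expr1 hN1 mulN1r.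
have Dr2 u : (r u)%:~R = W u + sg (W u) by rewrite Dr' Dh hN1 mulN1r.
have [[ua ua0 Da] _ [uc uc0 Dc] _] := weil_val_ex.
have rval u : u != 0 -> r u = r ua /\ (W u = a \/ W u = b) \/ r u = r uc /\ (W u = c \/ W u = d).
  move=> u0; case: (weil_val u0) => Du; [left|left|right|right]; split; auto.
  - by apply: (@intr_inj algC); rewrite !Dr2 Du Da.
  - by apply: (@intr_inj algC); rewrite !Dr2 Du Da sa sb addrC.
  - by apply: (@intr_inj algC); rewrite !Dr2 Du Dc.
  by apply: (@intr_inj algC); rewrite !Dr2 Du Dc sc sd addrC.
have [||||||||PQ [u0 u00 Du0]] := @two_valued_spike K p n 2 h r (r ua) (r uc) p_pr p5 cardK isT _ h_prim.
- exact: leq_trans q7.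
- exact: ray_sum0.
- by move=> u; apply: (ray_sum_galois h_prim Dr).
- exact: (sum_ray_sum (m := 2)).
- exact: sum_ray_sum2.
- by move=> u /rval[[]|[]]; [left|right].
- by exists ua.
- by exists uc.
have q_neq0 : #|K|%:Z != 0 by rewrite eqz_nat -lt0n (leq_trans _ q7).
have in_ray u : (u \in ray 2 h u0) = (u == u0) || (u == - u0).
  apply/imsetP/orP=> [[i _ ->]|].
    by case: i => [[|[|]] //= _]; rewrite ?mul1r ?hN1 ?mulN1r eqxx; auto.
  by case=> /eqP->; [exists ord0|exists (@Ordinal 2 1 isT)]; rewrite //= ?mul1r ?hN1 ?mulN1r.
have two0 : (2%:R : K) != 0 by apply: natr_neq0; clear -p5; lia.
have u0N : u0 != - u0.
  apply: contraNneq two0 => E; rewrite -(mulIr_eq0 _ (mulIf u00)).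
  by rewrite mulr_natl mulr2n {1}E addNr.
have Wsym u : W u + W (- u) = q * ((u == u0)%:R + (u == - u0)%:R).
  rewrite -Dr' Du0 in_ray; have [->|] := eqVneq u u0.
    by rewrite (negPf u0N) addr0 mulr1.
  by case: (u == - u0) => /= _; rewrite add0r ?mulr1 ?mulr0.
have off u : u != 0 -> u != u0 -> u != - u0 -> r u = 0.
  by move=> ? /negPf n1 /negPf n2; rewrite Du0 in_ray n1 n2.
case: PQ => -[Ea Ec].
- have ba : b = - a.
    by apply/eqP; rewrite -addr_eq0 addrC -sa -Da -Dr2 Ea.
  apply: (@no_antisymmetric_weil u0 a) => //.
  - by apply: contraNneq ab => a0; rewrite ba a0 oppr0.
  - by rewrite sa.
  move=> u n0 n1 n2; have r0 := off u n0 n1 n2.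
  case: (rval u n0) => -[ru W_u]; first by rewrite -ba.
  by case/eqP: q_neq0; rewrite -Ec -ru.
have dc : d = - c.
  by apply/eqP; rewrite -addr_eq0 addrC -sc -Dc -Dr2 Ec.
apply: (@no_antisymmetric_weil u0 c) => //.
- by apply: contraNneq cd => c0; rewrite dc c0 oppr0.
- by rewrite sc.
move=> u n0 n1 n2; have r0 := off u n0 n1 n2.
case: (rval u n0) => -[ru W_u]; last by rewrite -dc.
by case/eqP: q_neq0; rewrite -Ea -ru.
Qed.

Definition fiber (v : algC) := [set u : K | (u != 0) && (W u == v)].

Lemma sum_by_value (F : K -> algC) (f : algC -> algC) : F 0 = 0 ->
  (forall u, u != 0 -> F u = f (W u)) ->
  \sum_u F u = #|fiber a|%:R * f a + #|fiber b|%:R * f b +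
               #|fiber c|%:R * f c + #|fiber d|%:R * f d.
Proof.
move=> F0 DF; have [U _ _] := vals; move: U.
rewrite /= !inE !negb_or -!andbA => /and5P[ab ac ad bc /and3P[bd cd _]].
have Df v : #|fiber v|%:R * f v = \sum_u ((u != 0) && (W u == v))%:R * f v.
  rewrite -mulr_suml -natr_sum; congr (_%:R * _).
  by rewrite -sum1_card big_mkcond; apply: eq_bigr => u _; rewrite inE; case: ifP.
rewrite !Df -!big_split; apply: eq_bigr => u _ /=.
have [->|u0] /= := eqVneq u 0; first by rewrite F0 !mul0r !addr0.
rewrite DF //; case: (weil_val u0) => ->; rewrite eqxx.
- by rewrite (negPf ab) (negPf ac) (negPf ad) !mul0r mul1r !addr0.
- by rewrite (eq_sym b a) (negPf ab) (negPf bc) (negPf bd) !mul0r mul1r !addr0 add0r.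
- by rewrite (eq_sym c a) (eq_sym c b) (negPf ac) (negPf bc) (negPf cd) !mul0r mul1r !addr0 !add0r.
by rewrite (eq_sym d a) (eq_sym d b) (eq_sym d c) (negPf ad) (negPf bd) (negPf cd) !mul0r mul1r !add0r.
Qed.

Lemma no_transposition :
  sg a = b -> sg b = a -> sg c = c -> sg d = d -> False.
Proof.
move=> sa sb sc sd; have [U _ _] := vals; move: U.
rewrite /= !inE !negb_or -!andbA => /and5P[ab ac ad bc /and3P[bd cd _]].
have p_pr := pcharf_prime pchK; have p5 := prime_ge5; have odd_s := odd_exponent.
have h2 : h ^+ 2 = 1.
  by apply: galois_order => u /weil_val[] -> /=; rewrite ?(sa, sb, sc, sd).
have hN1 : h = -1 by move/eqP: h2; rewrite sqrf_eq1 (negPf h_neq1) => /eqP.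
have WN u : W (- u) = sg (W u) by rewrite Dh hN1 mulN1r.
have W0 : W 0 = 0 by apply: weil0.
have two0 : (2%:R : K) != 0 by apply: natr_neq0; clear -p5; lia.
have one_neqN1 : (1 == -1 :> K) = false.
  by apply/negbTE; apply: contra two0; rewrite -subr_eq0 opprK.
have q_neq0 := card_neq0 K.
have [[ua ua0 Da] _ [uc uc0 Dc] [ud ud0 Dd]] := weil_val_ex.
have [C DC dvC] : exists2 z : int, c = z%:~R & (p%:Z %| z)%Z.
  by rewrite -Dc; apply: weil_int; rewrite Dc.
have [E DE dvE] : exists2 z : int, d = z%:~R & (p%:Z %| z)%Z.
  by rewrite -Dd; apply: weil_int; rewrite Dd.
have [T DT _] : exists2 z : int, a + b = z%:~R & (p%:Z %| z)%Z.
  have -> : a + b = \sum_(u <- [:: ua; - ua]) W u.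
    by rewrite !big_cons big_nil addr0 WN Da sa.
  apply: weil_sum_int; rewrite !big_cons big_nil addr0 WN Da sa rmorphD /= sa sb.
  exact: addrC.
have [P DP _] : exists2 z : int, a * b = z%:~R & (p%:Z %| z)%Z.
  have -> : a * b = W ua * W (- ua) by rewrite WN Da sa.
  by apply: weil_mul_int; rewrite WN Da sa rmorphM /= sa sb mulrC.
have [Dl DDl] : exists z : int, z%:~R = (a - b) ^+ 2.
  exists (T ^+ 2 - 4 * P); rewrite rmorphB rmorphXn rmorphM /= -DT -DP; ring.
pose N := #|fiber a|; pose x := #|fiber c|; pose y := #|fiber d|.
have NE : #|fiber b| = N.
  rewrite -(card_imset _ (@oppr_inj K)) /N; congr #|pred_of_set _|; apply/setP=> u.
  rewrite -{1}[u]opprK (mem_imset _ _ (@oppr_inj _)) !inE oppr_eq0 WN -sa.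
  by rewrite (inj_eq (fmorph_inj sg)).
have sumW2 := sum_weil2 chi0 chiD chi_nt s_gt0 co_s odd_s.
have sumW2N : \sum_u W (- u) ^+ 2 = q ^+ 2.
  by rewrite -sumW2 [RHS](reindex_inj (@oppr_inj _)).
have sumWW : \sum_u W u * W (- u) = 0.
  have := sum_weil_mul chi0 chiD chi_nt s_gt0 co_s odd_s (-1).
  rewrite eq_sym one_neqN1 mulr0; apply: etrans.
  by apply: eq_bigr => u _; rewrite mulN1r.
have sumW : \sum_u W u = q by apply: sum_weil.
have sumWN : \sum_u W (- u) = q by rewrite -sumW [RHS](reindex_inj (@oppr_inj _)).
have eqZ (z1 z2 : int) : z1%:~R = z2%:~R :> algC -> z1 = z2 by apply: intr_inj.
(* Only the values [a] and [b] contribute to the sum of [(W u - W (- u))^2], which is [2 q^2]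
   because [W u] and [W (- u)] are orthogonal. *)
have NDl : N%:Z * Dl = #|K|%:Z ^+ 2.
  apply: eqZ; rewrite rmorphM rmorphXn /= -!pmulrn DDl.
  apply: (@mulfI _ 2); first by rewrite pnatr_eq0.
  transitivity (\sum_u (W u - W (- u)) ^+ 2).
    rewrite (@sum_by_value _ (fun v => (v - sg v) ^+ 2)) ?oppr0 ?subrr ?expr0n // => [|u _].
      by rewrite sa sb sc sd NE; ring.
    by rewrite WN.
  rewrite (eq_bigr (fun u => W u ^+ 2 + W (- u) ^+ 2 - 2 * (W u * W (- u)))) => [|u _]; last by ring.
  by rewrite !big_split /= sumrN -mulr_sumr sumW2 sumW2N sumWW; ring.
have moment1 : N%:Z * T + x%:Z * C + y%:Z * E = #|K|%:Z.
  apply: eqZ; rewrite !rmorphD !rmorphM /= -!pmulrn -DT -DC -DE -[RHS]sumW.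
  by rewrite (@sum_by_value _ id) // NE; ring.
have moment2 : N%:Z * T ^+ 2 + 2 * x%:Z * C ^+ 2 + 2 * y%:Z * E ^+ 2 = #|K|%:Z ^+ 2.
  apply: eqZ; rewrite !(rmorphD, rmorphXn, rmorphM) /= -!pmulrn -DT -DC -DE -/N -/x -/y.
  apply: (@mulfI _ 2); first by rewrite pnatr_eq0.
  transitivity (\sum_u (W u + W (- u)) ^+ 2).
    rewrite (@sum_by_value _ (fun v => (v + sg v) ^+ 2)) ?oppr0 ?W0 ?addr0 ?expr0n // => [|u _].
      by rewrite sa sb sc sd NE; ring.
    by rewrite WN.
  rewrite (eq_bigr (fun u => W u ^+ 2 + W (- u) ^+ 2 + 2 * (W u * W (- u)))) => [|u _]; last by ring.
  by rewrite !big_split /= -mulr_sumr sumW2 sumW2N sumWW; ring.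
have moment4 : 8 * #|K|%:Z ^+ 2 * (\sum_(v : K) (fsum s v)%:Z ^+ 2) =
  N%:Z * (T ^+ 4 + 6 * T ^+ 2 * Dl + Dl ^+ 2) + 8 * (x%:Z * C ^+ 4 + y%:Z * E ^+ 4).
  (* The 8 clears the denominator in [a^4 + b^4 = (T^4 + 6 T^2 Dl + Dl^2) / 8]. *)
  apply: eqZ; transitivity (8 * \sum_u W u ^+ 4).
    rewrite (sum_weil4 chi0 chiD chi_nt s_gt0 co_s odd_s) !(rmorphXn, rmorphM) rmorph_sum /=.
    rewrite -!pmulrn -mulrA; congr (_ * (_ * _)); apply: eq_bigr => v _.
    by rewrite rmorphXn /= -pmulrn.
  rewrite (@sum_by_value _ (fun v => v ^+ 4)) ?W0 ?expr0n // NE.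
  rewrite !(rmorphD, rmorphXn, rmorphM) /= DDl -!pmulrn -DT -DC -DE -/N -/x -/y.
  by ring.
(* If [N = 1] then [a - b] is [q] or [- q], hence fixed by [sg], which negates it. *)
have N_gt1 : (1 < N)%N.
  have N_gt0 : (0 < N)%N by apply/card_gt0P; exists ua; rewrite inE ua0 Da eqxx.
  rewrite ltn_neqAle N_gt0 andbT; apply/eqP=> N1.
  have : (a - b) ^+ 2 == q ^+ 2.
    by rewrite -DDl; move: NDl; rewrite -N1 mul1r => ->; rewrite rmorphXn /= -pmulrn.
  rewrite eqf_sqr => E'.
  have : sg (a - b) = a - b.
    by case/orP: E' => /eqP->; rewrite ?rmorphN /= rmorph_nat.
  rewrite rmorphB /= sa sb => /eqP; rewrite -subr_eq0.
  have -> : b - a - (a - b) = -2 * (a - b) by ring.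
  by rewrite mulf_eq0 oppr_eq0 pnatr_eq0 subr_eq0 (negPf ab).
have two_le (w : K) v : w != 0 -> W w = v -> sg v = v -> (1 < #|fiber v|)%N.
  move=> w0 Dv sv; have wN : w != - w.
    apply: contraNneq two0 => Ew; rewrite -(mulIr_eq0 _ (mulIf w0)).
    by rewrite mulr_natl mulr2n {1}Ew addNr.
  rewrite -[X in (X <= _)%N](_ : #|[set w; - w]| = 2%N); last by rewrite cards2 wN.
  apply/subset_leq_card/subsetP=> u; rewrite !inE => /orP[]/eqP->.
    by rewrite w0 Dv eqxx.
  by rewrite oppr_eq0 w0 WN Dv sv eqxx.
have x_gt1 : (1 < x)%N := two_le uc c uc0 Dc sc.
have y_gt1 : (1 < y)%N := two_le ud d ud0 Dd sd.
have q_gt6 : (6 < #|K|)%N.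
  have : #|K|%:Z - 1 = 2 * N%:Z + x%:Z + y%:Z.
    apply: eqZ; transitivity (\sum_(u : K) ((u != 0)%:R : algC)).
      rewrite (bigD1 0) //= eqxx add0r (eq_bigr (fun=> 1)) => [|u ->] //.
      rewrite sumr_const cardC1 rmorphB /= -pmulrn -subn1 natrB // ltnW //.
      exact: card_gt1.
    rewrite (@sum_by_value _ (fun=> 1)) ?eqxx // => [|u ->] //.
    by rewrite NE !(rmorphD, rmorphM) /= -!pmulrn -/N -/x -/y; ring.
  by move: N_gt1 x_gt1 y_gt1; clear; lia.
have bound : 4 * (C ^+ 2 + E ^+ 2) <= #|K|%:Z ^+ 2.
  rewrite -moment2; have := sqr_ge0 C; have := sqr_ge0 E; have := sqr_ge0 T.
  by move: N_gt1 x_gt1 y_gt1; clear; move: (T ^+ 2) (C ^+ 2) (E ^+ 2) => u v w; nia.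
pose t (v : K) : algC := (fsum s v)%:R; pose m (v : K) : algC := (fdif s v)%:R.
have rootK v : exists z : K, z ^+ s = v.
  by have [i Di] := power_map_root s_gt0 co_s; exists (v ^+ i); rewrite -exprM mulnC.
have S2 z : \sum_u W u ^+ 2 * chi (u * z) = q * fourier chi t (z ^+ s) by apply: sum_weil2_fsum.
have S2N z : \sum_u W (- u) ^+ 2 * chi (u * z) = q * fourier chi t (- z ^+ s).
  rewrite -exprN_odd // -S2 [RHS](reindex_inj (@oppr_inj _)).
  by apply: eq_bigr => u _ /=; rewrite mulNr mulrN opprK.
have S1 z : \sum_u W u * chi (u * z) = q * chi (z ^+ s) by apply: sum_weil_chi.
have S1N z : \sum_u W (- u) * chi (u * z) = q * chi (- z ^+ s).
  rewrite -exprN_odd // -S1 [RHS](reindex_inj (@oppr_inj _)).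
  by apply: eq_bigr => u _ /=; rewrite mulNr mulrN opprK.
have S11 z : z != 0 -> \sum_u W u * W (- u) * chi (u * z) = q * fourier chi m (z ^+ s).
  by move=> z0; apply: sum_weilN_fdif.
have W_cases u : [\/ [/\ W u = 0, W (- u) = 0 & u = 0],
    [/\ W u = a, W (- u) = b & u != 0], [/\ W u = b, W (- u) = a & u != 0] |
    [/\ W u = W (- u), W u = c \/ W u = d & u != 0]].
  have [->|u0] := eqVneq u 0; first by constructor 1; rewrite oppr0.
  rewrite WN; case: (weil_val u0) => ->; [constructor 2|constructor 3|constructor 4|constructor 4];
    by rewrite ?sa ?sb ?sc ?sd; split; auto.
(* This is the Fourier transform of [W u ^+ 2 - W (- u) ^+ 2 = T (W u - W (- u))], valid for every
   [u]. *)
have t_sym v : t v = t (- v) + T%:~R * ((v == 1)%:R - (v == -1)%:R).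
  apply/eqP; rewrite -subr_eq0; apply/eqP.
  pose f v := t v + -1 * t (- v) + - T%:~R * (v == 1)%:R + T%:~R * (v == -1)%:R.
  rewrite [LHS](_ : _ = f v); last by rewrite /f; ring.
  apply: (mulfI q_neq0); rewrite -(fourierK chi0 chiD chi_nt) mulr0 big1 // => b' _.
  suff -> : fourier chi f b' = 0 by rewrite mul0r.
  have [z <-] := rootK b'.
  rewrite /f 3!fourierD !fourierZ !fourier_delta (fourierN chi t) mulrN !mulr1.
  apply: (mulfI q_neq0); rewrite mulr0 !mulrDr.
  transitivity (\sum_u (W u ^+ 2 - W (- u) ^+ 2 - T%:~R * (W u - W (- u))) * chi (u * z)).
    rewrite (eq_bigr (fun u => W u ^+ 2 * chi (u * z) + -1 * (W (- u) ^+ 2 * chi (u * z))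
      + - T%:~R * (W u * chi (u * z)) + T%:~R * (W (- u) * chi (u * z)))) => [|u _]; last by ring.
    by rewrite !big_split -!mulr_sumr /= S2 S2N S1 S1N; ring.
  rewrite big1 // => u _; rewrite -DT.
  by case: (W_cases u) => [[-> -> _]|[-> -> _]|[-> -> _]|[-> _ _]]; ring.
(* With [S = W u + W (- u)], the conic [Dl (S - 2 c) (S - 2 d) = L (W u - W (- u))^2] passes through
   [(a, b)], [(b, a)], [(c, c)] and [(d, d)]; at [u = 0] the difference of the sides is [4 c d Dl].
   [lin] is this relation summed against a test function [k]. *)
pose L := (T%:~R - 2 * c) * (T%:~R - 2 * d).
have lin (k : K -> algC) :
    (Dl%:~R - L) * (\sum_u W u ^+ 2 * k u) + (Dl%:~R - L) * (\sum_u W (- u) ^+ 2 * k u)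
    + 2 * (Dl%:~R + L) * (\sum_u W u * W (- u) * k u)
    - 2 * (c + d) * Dl%:~R * (\sum_u W u * k u + \sum_u W (- u) * k u)
    + 4 * (c * d) * Dl%:~R * (\sum_u k u) = 4 * (c * d) * Dl%:~R * k 0.
  transitivity (\sum_u 4 * (c * d) * Dl%:~R * ((u == 0)%:R * k u)); last first.
    rewrite -mulr_sumr (bigD1 0) //= eqxx mul1r big1 ?addr0 // => u /negPf->.
    by rewrite mul0r.
  rewrite [RHS](eq_bigr (fun u => (Dl%:~R - L) * (W u ^+ 2 * k u)
    + (Dl%:~R - L) * (W (- u) ^+ 2 * k u) + 2 * (Dl%:~R + L) * (W u * W (- u) * k u)
    + - (2 * (c + d) * Dl%:~R) * (W u * k u) + - (2 * (c + d) * Dl%:~R) * (W (- u) * k u)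
    + 4 * (c * d) * Dl%:~R * k u)) => [|u _].
    by rewrite !big_split /= -!mulr_sumr; ring.
  rewrite DDl /L -DT; case: (W_cases u).
  - by case=> -> -> ->; rewrite eqxx mul1r; ring.
  - by case=> -> -> /negPf->; rewrite mul0r; ring.
  - by case=> -> -> /negPf->; rewrite mul0r; ring.
  by case=> <- Dw /negPf->; rewrite mul0r; case: Dw => ->; ring.
have [th thE] : exists z : int, z = #|K|%:Z * (C + E) - (#|K|%:Z - 1) * (C * E).
  by exists (#|K|%:Z * (C + E) - (#|K|%:Z - 1) * (C * E)).
have Dth : th%:~R = q * (c + d) - (q - 1) * (c * d).
  by rewrite thE rmorphB !rmorphM rmorphB rmorphD /= -!pmulrn -DC -DE.
have NDl' : N%:R * Dl%:~R = q ^+ 2 :> algC.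
  by have := congr1 (fun z : int => z%:~R : algC) NDl; rewrite /= rmorphM rmorphXn /= -!pmulrn.
(* The constant test function determines [L]. Then [N (Dl - L) = 2 th] and
   [N (Dl + L) = 2 (q^2 - th)], the coefficients in [flat]. *)
have NL : N%:R * L = q ^+ 2 - 2 * th%:~R.
  apply: (@mulfI _ (2 * q ^+ 2)); first by rewrite mulf_neq0 ?(expf_neq0 2 q_neq0) ?pnatr_eq0.
  have drop1 (F : K -> algC) : \sum_u F u * 1 = \sum_u F u.
    by apply: eq_bigr => u _; rewrite mulr1.
  have := lin (fun=> 1); rewrite !drop1 sumr_const sumW2 sumW2N sumWW sumW sumWN.
  move=> /(congr1 (fun z => N%:R * z))/eqP; rewrite -subr_eq0 => /eqP eqL.
  transitivity ((2 * q ^+ 2 - 4 * (c + d) * q + 4 * (c * d) * (q - 1)) * (N%:R * Dl%:~R)).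
    by rewrite -[LHS]addr0 -eqL; ring.
  by rewrite NDl' Dth; ring.
(* The transform of this combination of [fsum], [fdif] and delta functions
   vanishes off [0], so the combination is constant. *)
have flat v w : th%:~R * t v + th%:~R * t (- v) + 2 * (q ^+ 2 - th%:~R) * m v
    + - ((c + d) * q ^+ 2) * (v == 1)%:R + - ((c + d) * q ^+ 2) * (v == -1)%:R
    + - (2 * (c * d) * q) * (v == 0)%:R =
    th%:~R * t w + th%:~R * t (- w) + 2 * (q ^+ 2 - th%:~R) * m w
    + - ((c + d) * q ^+ 2) * (w == 1)%:R + - ((c + d) * q ^+ 2) * (w == -1)%:R
    + - (2 * (c * d) * q) * (w == 0)%:R.
  pose f v := th%:~R * t v + th%:~R * t (- v) + 2 * (q ^+ 2 - th%:~R) * m v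
    + - ((c + d) * q ^+ 2) * (v == 1)%:R + - ((c + d) * q ^+ 2) * (v == -1)%:R
    + - (2 * (c * d) * q) * (v == 0)%:R.
  rewrite -/(f v) -/(f w); apply: (fourier_const chi0 chiD chi_nt) => b' b'0.
  have [z Dz] := rootK b'.
  have z0 : z != 0 by apply: contraNneq b'0 => z0; rewrite -Dz z0 expr0n gtn_eqF.
  rewrite /f 5!fourierD !fourierZ !fourier_delta (fourierN chi t) mulrN mulr0 chi0 !mulr1 -Dz.
  have := lin (fun u => chi (u * z)); rewrite S2 S2N S11 // S1 S1N mul0r chi0.
  rewrite (eq_bigr (fun u => chi (z * u))) => [|u _]; last by rewrite mulrC.
  rewrite sum_chi // (negPf z0) !mulr0 addr0 mulr1 => eqL.
  apply: (mulfI (_ : 2 * q != 0)); first by rewrite mulf_neq0 ?q_neq0 ?pnatr_eq0.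
  move: eqL; move: (fourier chi t _) (fourier chi t _) (fourier chi m _) => X Y M.
  move=> /(congr1 (fun w => N%:R * w))/eqP; rewrite -subr_eq0 => /eqP eqL.
  transitivity ((N%:R * Dl%:~R - N%:R * L) * (q * X + q * Y)
    + 2 * (N%:R * Dl%:~R + N%:R * L) * (q * M)
    - 2 * (c + d) * (N%:R * Dl%:~R) * (q * chi (z ^+ s) + q * chi (- z ^+ s))
    - 4 * (c * d) * (N%:R * Dl%:~R)).
    by rewrite NDl' NL; ring.
  by rewrite mulr0 -[RHS]eqL; ring.
have t0 : t 0 = 0 by rewrite /t fsum0.
have m0 : m 0 = 1 by rewrite /m fdif0.
have [o10 oN10] : (0 == 1 :> K) = false /\ (0 == -1 :> K) = false.
  by rewrite eq_sym oner_eq0 eq_sym oppr_eq0 oner_eq0.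
have ns1 : (fsum s (1 : K))%:Z = T + (fsum s (-1 : K))%:Z.
  apply: eqZ; have := t_sym 1; rewrite eqxx one_neqN1 subr0 mulr1 addrC /t => E1.
  by rewrite rmorphD /= -!pmulrn E1.
have gN1 : (g%:R : K) ^+ s.-1 = -1 by rewrite -h_s hN1 exprN_odd // expr1n.
(* Writing [2 = g^i] and using [g^(s-1) = -1] shows that the exceptional value [2 * 2^(-s)] of
   [fsum_even] is 1 or [-1]. *)
have pow2 : (2%:R : K) ^+ s.-1 = 1 \/ (2%:R : K) ^+ s.-1 = -1.
  have : (2%:R : K) ^+ p.-1 = 1.
    apply/unity_rootP/(allP (natr_units_unity pchK))/map_f.
    by rewrite mem_iota; clear -p5; lia.
  case/(prim_rootP g_prim) => i ->; rewrite exprAC gN1 -signr_odd.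
  by case: (odd i); [right|left].
have mE v : (m v : algC) = ((fdif s v)%:Z)%:~R by rewrite /m pmulrn.
have tE v : (t v : algC) = ((fsum s v)%:Z)%:~R by rewrite /t pmulrn.
apply: (@transposition_arith K p n p_pr p5 cardK two0 (@fsum K s) (@fdif K s) N x y T C E Dl) => //.
- exact: fsum0.
- exact: fdif0.
- exact: fdif1.
- by rewrite fdifN fdif1.
- move=> v v1 vN1; apply: fsum_even => //; apply/eqP=> Dv.
  have : v * 2%:R ^+ s.-1 = 1.
    by rewrite Dv mulrAC -exprS prednK // -exprMn divff // expr1n.
  by case: pow2 => ->; rewrite ?mulrN mulr1 => E'; [rewrite E' eqxx in v1|rewrite -E' opprK eqxx in vN1].
- exact: sum_card_fiber.
- exact: sum_card_fiber.
- move=> v; rewrite !inE !negb_or => /and3P[v0 v1 vN1]; rewrite -thE; apply: eqZ.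
  have := flat v 0; have := t_sym v.
  rewrite oppr0 t0 m0 eqxx o10 oN10 (negPf v0) (negPf v1) (negPf vN1) subrr mulr0 addr0 => <-.
  move/eqP; rewrite -subr_eq0 /= => /eqP E1.
  rewrite !(rmorphD, rmorphB, rmorphN, rmorphXn, rmorphM) /= -tE -mE -!pmulrn -DC -DE.
  apply: (@mulfI _ 2); first by rewrite pnatr_eq0.
  by rewrite -[RHS]addr0 -E1; ring.
- rewrite -thE; apply: eqZ.
  have := flat 1 0; rewrite t_sym oppr0 t0 m0 !eqxx o10 oN10 one_neqN1 oner_eq0.
  have -> : m 1 = t (-1) + 1 by rewrite /m fdif1 // -natr1.
  move/eqP; rewrite -subr_eq0 /= => /eqP E1.
  rewrite !(rmorphD, rmorphB, rmorphN, rmorphXn, rmorphM) /= -tE -!pmulrn -DC -DE.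
  by rewrite -[RHS]E1; ring.
by apply: contraNneq cd => CE; rewrite DC DE CE.
Qed.

End Cycles.

End GaloisAction.

(** If [sg] fixes all four values they are integers by [weil_int]; otherwise [sg] permutes them
    nontrivially and each cycle type is excluded, the four-cycle by [q != 5]. *)
Lemma four_valued_weil_int (K : finFieldType) (chi : K -> algC) (p n s : nat) (vs : seq algC) :
  chi 0 = 1 -> (forall x y, chi (x + y) = chi x * chi y) ->
  (exists x, chi x != 1) -> p \in [pchar K] -> #|K| = (p ^ n)%N ->
  (0 < s)%N -> coprime s #|K|.-1 -> size vs = 4%N -> weil_values chi s vs ->
  #|K| != 5%N -> forall u, weil chi s u \in Num.int.
Proof.
move=> chi0 chiD chi_nt pchK cardK s_gt0 co_s sz4 [Uvs vsP exP] qn5.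
have [g [sg [g_prim Dsg]]] := chi_galois chi0 chiD pchK.
have [h h_s Dh] := galois_weil pchK s_gt0 co_s g_prim Dsg.
have [fix_vs|] := boolP (all (fun v => sg v == v) vs).
  move=> u; have [->|u0] := eqVneq u 0; first by rewrite (weil0 chi0 chiD chi_nt s_gt0 co_s) rpred0.
  have /eqP fixW := allP fix_vs _ (vsP u u0).
  by have [z -> _] := weil_int chi0 chiD pchK cardK g_prim Dsg fixW; rewrite intr_int.
case/allPn=> v v_vs sv; have [w w0 Dw] := exP _ v_vs.
have h1 : h != 1 by apply: contraNneq sv => h1; rewrite -Dw Dh h1 mul1r.
have h0 := galois_neq0 pchK s_gt0 g_prim h_s.
have stab : {in vs, forall v, sg v \in vs}.
  by move=> _ /exP[u u0 <-]; rewrite Dh vsP // mulf_neq0.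
have [|a [b [c [d [mem_vs U cyc]]]]] := perm4_cycle_type Uvs sz4 stab (fmorph_inj sg).
  by exists v.
have vals : weil_values chi s [:: a; b; c; d].
  by split=> // [u u0|v']; rewrite -mem_vs; [apply: vsP | apply: exP].
exfalso; case: cyc => -[sa sb sc sd].
- exact: (@no_transposition K chi p n s g sg chi0 chiD chi_nt pchK cardK s_gt0 co_s g_prim Dsg h h_s Dh h1 a b c d).
- exact: (@no_two_two K chi p n s g sg chi0 chiD chi_nt pchK cardK s_gt0 co_s g_prim Dsg h h_s Dh h1 a b c d).
- exact: (@no_three_cycle K chi p n s g sg chi0 chiD chi_nt pchK cardK s_gt0 co_s g_prim Dsg h h_s Dh h1 a b c d).
have := @no_four_cycle K chi p n s g sg chi0 chiD chi_nt pchK cardK s_gt0 co_s g_prim Dsg h h_s Dh h1 a b c d.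
by move=> /(_ vals sa sb sc sd) q5; rewrite q5 in qn5.
Qed.

(** * The field with five elements *)

Section FiveElements.

Variables (K : finFieldType) (chi : K -> algC) (s : nat).
Hypotheses (chi0 : chi 0 = 1) (chiD : forall x y, chi (x + y) = chi x * chi y).
Hypothesis chi_nt : exists x, chi x != 1.
Hypotheses (pchK : 5%N \in [pchar K]) (card5 : #|K| = 5%N).
Hypotheses (s_gt0 : (0 < s)%N) (co_s : coprime s #|K|.-1).

Lemma expr_mod4 (x : K) r : (s %% 4 = r.+1)%N -> x ^+ s = x ^+ r.+1.
Proof.
move=> sr; have [->|x0] := eqVneq x 0; first by rewrite !expr0n gtn_eqF.
have x4 : x ^+ 4 = 1.
  by apply: (mulfI x0); rewrite -exprS mulr1 -[in LHS]card5 expf_card.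
by rewrite -sr -(expr_mod s x4).
Qed.

Lemma mod4_cases : (s %% 4 = 1)%N \/ (s %% 4 = 3)%N.
Proof.
have : coprime (s %% 4)%N 4 by rewrite coprime_modl; move: co_s; rewrite card5.
by case: (s %% 4)%N (ltn_pmod s (isT : 0 < 4)%N) => [|[|[|[|]]]] //; auto.
Qed.

Lemma weil5_deg1 : (s %% 4 = 1)%N -> forall u, u != 1 -> weil chi s u = 0.
Proof.
move=> s1 u u1; rewrite /weil (eq_bigr (fun x => chi ((1 - u) * x))) => [|x _].
  by rewrite sum_chi // subr_eq0 eq_sym (negPf u1) mulr0.
by rewrite (expr_mod4 x s1) expr1 mulrBl mul1r.
Qed.

Lemma natr5_bij : bijective (fun k : 'I_5 => k%:R : K).
Proof.
apply: inj_card_bij; last by rewrite card5 card_ord.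
by move=> i j /(natr_eq_mod pchK); rewrite !modn_small // => /val_inj.
Qed.

(** The coefficient 4 stands for [-1], which keeps the exponent a natural number. *)
Lemma weil5_natr m : (s %% 4 = 3)%N ->
  weil chi s (m%:R) = \sum_(k < 5) chi 1 ^+ ((k ^ 3 + 4 * m * k) %% 5)%N.
Proof.
move=> s3; rewrite /weil (reindex _ (onW_bij _ natr5_bij)); apply: eq_bigr => k _ /=.
rewrite (expr_mod4 _ s3) (expr_mod _ (chi_unity chi0 chiD pchK 1)) -(chiMn chi0 chiD).
congr chi; rewrite natrD natrX !natrM (_ : 4%:R = -1 :> K); first by ring.
by apply/eqP; rewrite -subr_eq0 opprK natr1 (pcharf0 pchK).
Qed.

(** The values are [3 + y], [1 + 2 y], [- 1 - 2 y] and [2 - y], where [2 y + 1] is a square root of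
    5. Either sign of the root gives the same set, so it need not be determined. *)
Lemma weil5_values : (s %% 4 = 3)%N ->
  forall v, (exists2 u, u != 0 & weil chi s u = v) <->
    v \in [:: (5 + sqrtC 5) / 2; (5 - sqrtC 5) / 2; sqrtC 5; - sqrtC 5].
Proof.
move=> s3; pose z := chi 1; pose y := z + z ^+ 4; pose r : algC := sqrtC 5.
have natr5 x : exists k : 'I_5, x = k%:R :> K.
  by have [f _ fK] := natr5_bij; exists (f x); rewrite fK.
have z1 : z != 1.
  have [x x1] := chi_nt; apply: contra x1 => /eqP z1; have [k ->] := natr5 x.
  by rewrite (chiMn chi0 chiD) -/z z1 expr1n.
have z5 : z ^+ 5 = 1 by apply: chi_unity.
have sumz : 1 + z + z ^+ 2 + z ^+ 3 + z ^+ 4 = 0.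
  apply: (mulfI (_ : z - 1 != 0)); first by rewrite subr_eq0.
  by rewrite mulr0; transitivity (z ^+ 5 - 1); [ring | rewrite z5 subrr].
have W1 : weil chi s 1%:R = 3 + y.
  rewrite weil5_natr // -/z; transitivity (z ^+ 0 + (z ^+ 0 + (z ^+ 1 + (z ^+ 4 + z ^+ 0)))).
    by rewrite !big_ord_recl big_ord0 addr0.
  by rewrite /y; ring.
have W2 : weil chi s 2%:R = 1 + 2 * y.
  rewrite weil5_natr // -/z; transitivity (z ^+ 0 + (z ^+ 4 + (z ^+ 4 + (z ^+ 1 + z ^+ 1)))).
    by rewrite !big_ord_recl big_ord0 addr0.
  by rewrite /y; ring.
have W3 : weil chi s 3%:R = - 1 - 2 * y.
  rewrite weil5_natr // -/z; transitivity (z ^+ 0 + (z ^+ 3 + (z ^+ 2 + (z ^+ 3 + z ^+ 2)))).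
    by rewrite !big_ord_recl big_ord0 addr0.
  by rewrite -[RHS]addr0 -(mulr0 2) -sumz /y; ring.
have W4 : weil chi s 4%:R = 2 - y.
  rewrite weil5_natr // -/z; transitivity (z ^+ 0 + (z ^+ 2 + (z ^+ 0 + (z ^+ 0 + z ^+ 3)))).
    by rewrite !big_ord_recl big_ord0 addr0.
  by rewrite -[RHS]addr0 -sumz /y; ring.
have yy : y ^+ 2 = z ^+ 2 + 2 + z ^+ 3.
  transitivity (z ^+ 2 + 2 * z ^+ 5 + z ^+ 5 * z ^+ 3); first by rewrite /y; ring.
  by rewrite z5; ring.
have y2 : (2 * y + 1) ^+ 2 = 5.
  transitivity (4 * y ^+ 2 + 4 * y + 1); first by ring.
  by rewrite yy -[RHS]addr0 -(mulr0 4) -sumz /y; ring.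
have r2 : r ^+ 2 = 5 by apply: sqrtCK.
have k0 k : (0 < k < 5)%N -> (k%:R : K) != 0.
  by case/andP=> k_gt0 k5; rewrite -(dvdn_pcharf pchK) gtnNdvd.
have ex k w : (0 < k < 5)%N -> weil chi s k%:R = w -> exists2 u, u != 0 & weil chi s u = w.
  by move=> k5 Dw; exists k%:R; [apply: k0 | ].
have Wn u : u != 0 -> weil chi s u \in [:: 3 + y; 1 + 2 * y; - 1 - 2 * y; 2 - y].
  have [k ->] := natr5 u; case: k => [[|[|[|[|[|]]]]] //= _].
  - by rewrite eqxx.
  - by rewrite W1 inE eqxx.
  - by rewrite W2 !inE eqxx orbT.
  - by rewrite W3 !inE eqxx !orbT.
  by rewrite W4 !inE eqxx !orbT.
have mem_W v : (exists2 u, u != 0 & weil chi s u = v) <->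
    v \in [:: 3 + y; 1 + 2 * y; - 1 - 2 * y; 2 - y].
  split=> [[u u0 <-]|]; first exact: Wn.
  by rewrite !inE => /or4P[]/eqP->; [apply: (ex 1%N)|apply: (ex 2)|apply: (ex 3)|apply: (ex 4)].
have /orP[/eqP Er|/eqP Er] : (2 * y + 1 == r) || (2 * y + 1 == - r).
- by rewrite -eqf_sqr y2 r2.
- have Dy : y = (r - 1) / 2 by rewrite -Er; field.
  move=> v; rewrite mem_W -/r Dy.
  have -> : 3 + (r - 1) / 2 = (5 + r) / 2 by field.
  have -> : 1 + 2 * ((r - 1) / 2) = r by field.
  have -> : - 1 - 2 * ((r - 1) / 2) = - r by field.
  have -> : 2 - (r - 1) / 2 = (5 - r) / 2 by field.
  rewrite !inE; split=> /or4P[]->; by rewrite ?orbT.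
have Dy : y = (- r - 1) / 2 by rewrite -Er; field.
move=> v; rewrite mem_W -/r Dy.
have -> : 3 + (- r - 1) / 2 = (5 - r) / 2 by field.
have -> : 1 + 2 * ((- r - 1) / 2) = - r by field.
have -> : - 1 - 2 * ((- r - 1) / 2) = r by field.
have -> : 2 - (- r - 1) / 2 = (5 + r) / 2 by field.
by rewrite !inE; split=> /or4P[]->; rewrite ?orbT.
Qed.

End FiveElements.

(** * The canonical additive character *)

(** The chosen root of [-1] is not 1, since its [p]-th power is [-1], and not [-1], since [rootC] is
    never negative for [p > 1]; so its square is not 1. *)
Lemma zeta_prim p : prime p -> p.-primitive_root (zeta p).
Proof.
move=> p_pr; have p_gt0 := prime_gt0 p_pr.
have rp : (p.-root (-1) : algC) ^+ p = -1 by apply: rootCK.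
apply: prim_root_prime => //; first by rewrite exprAC rp sqrrN expr1n.
rewrite sqrf_eq1; apply/norP; split.
  apply: contra_eq_neq rp => ->; rewrite expr1n -subr_eq0 opprK.
  by rewrite -[1 + 1]/(2%:R) pnatr_eq0.
by apply/eqP=> r1; have := rootC_lt0 (-1 : algC) (prime_gt1 p_pr); rewrite r1 ltrN10.
Qed.

Section CanonicalCharacter.

Variables (K : finFieldType) (p n : nat).
Hypotheses (pchK : p \in [pchar K]) (cardK : #|K| = (p ^ n)%N).

Lemma absTrD (x y : K) : absTr p n (x + y) = absTr p n x + absTr p n y.
Proof.
rewrite -big_split; apply: eq_bigr => i _ /=.
elim: (i : nat) => [|k IHk]; first by rewrite !expr1.
by rewrite expnSr !exprM IHk -!(pFrobenius_autE pchK) rmorphD.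
Qed.

Lemma absTr_frobenius (x : K) : absTr p n x ^+ p = absTr p n x.
Proof.
rewrite -(pFrobenius_autE pchK) rmorph_sum /=.
have n_gt0 := card_exp_gt0 cardK.
case: n n_gt0 cardK => // m _ cardKm; rewrite big_ord_recr [RHS]big_ord_recl /= addrC.
congr (_ + _).
  by rewrite pFrobenius_autE -exprM -expnSr -cardKm expf_card expr1.
by apply: eq_bigr => i _; rewrite pFrobenius_autE -exprM -expnSr.
Qed.

Lemma frobenius_fixed (y : K) : y ^+ p = y -> exists k : 'I_p, y = k%:R.
Proof.
move=> yp; have p_pr := pcharf_prime pchK; have p_gt0 := prime_gt0 p_pr.
have natr_mod k : (k%:R : K) = (k %% p)%:R.
  by rewrite {1}(divn_eq k p) natrD natrM (pcharf0 pchK) mulr0 add0r.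
have [->|y0] := eqVneq y 0; first by exists (Ordinal p_gt0).
have [g g_prim] := natr_prim_root pchK.
have : y ^+ p.-1 = 1 by apply: (mulfI y0); rewrite -exprS prednK // mulr1.
case/(prim_rootP g_prim) => i ->; exists (Ordinal (ltn_pmod (g ^ i)%N p_gt0)).
by rewrite -natrX [LHS]natr_mod.
Qed.

(** The trace is fixed by Frobenius, so it lies in the prime field and the default value in [trNat]
    is never reached. *)
Lemma trNatE (x : K) : (trNat p n x)%:R = absTr p n x.
Proof.
rewrite /trNat; case: pickP => [k /eqP //|noK].
by have [k Dk] := frobenius_fixed (absTr_frobenius x); have := noK k; rewrite Dk eqxx.
Qed.

Lemma psiD (x y : K) : psi p n (x + y) = psi p n x * psi p n y.
Proof.
rewrite /psi -exprD; have z_prim := zeta_prim (pcharf_prime pchK).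
apply/eqP; rewrite (eq_prim_root_expr z_prim); apply/eqP/(natr_eq_mod pchK).
by rewrite natrD !trNatE absTrD.
Qed.

Lemma psi0 : psi p n (0 : K) = 1.
Proof.
have z_prim := zeta_prim (pcharf_prime pchK).
rewrite /psi -(expr0 (zeta p)); apply/eqP; rewrite (eq_prim_root_expr z_prim).
apply/eqP/(natr_eq_mod pchK); rewrite trNatE /absTr big1 // => i _.
by rewrite expr0n expn_eq0 eqn0Ngt prime_gt0 ?(pcharf_prime pchK).
Qed.

(** Otherwise the trace polynomial, of degree [p^(n-1)], would have all [p^n] elements of [K] as
    roots. *)
Lemma psi_nontrivial : exists x : K, psi p n x != 1.
Proof.
have p_pr := pcharf_prime pchK; have p_gt1 := prime_gt1 p_pr.
have z_prim := zeta_prim p_pr.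
apply/existsP; apply: contraT; rewrite negb_exists => /forallP psi1.
have tr0 (x : K) : absTr p n x = 0.
  have := psi1 x; rewrite negbK /psi -(prim_order_dvd z_prim) => dv.
  by rewrite -trNatE; apply/eqP; rewrite -(dvdn_pcharf pchK).
have n_gt0 := card_exp_gt0 cardK.
pose P : {poly K} := \sum_(i < n) 'X^(p ^ i).
have szP : size P = (p ^ n.-1).+1.
  rewrite /P; case: n n_gt0 => // m _; rewrite big_ord_recr /= addrC size_polyDl ?size_polyXn //.
  rewrite ltnS; apply: (leq_trans (size_sum _ _ _)); apply/bigmax_leqP => i _.
  by rewrite size_polyXn ltn_exp2l.
have P0 : P != 0 by rewrite -size_poly_eq0 szP.
have rootP : all (root P) (enum K).
  apply/allP=> x _; rewrite rootE horner_sum; apply/eqP.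
  by rewrite -[RHS](tr0 x); apply: eq_bigr => i _; rewrite hornerXn.
have := max_poly_roots P0 rootP (enum_uniq K).
rewrite szP -cardE ltnS leqNgt cardK ltn_exp2l //.
by case: n n_gt0 => //= m _; rewrite ltnSn.
Qed.

End CanonicalCharacter.

(** * The theorem for the canonical character *)

Theorem theorem1p5 (K : finFieldType) (p n : nat)
  (hp : (p \in [pchar K])%N) (hq : #|K| = (p ^ n)%N)
  (s : nat) (hs : (0 < s)%N) (hcop : coprime s (#|K|).-1) :
  size (Wset K p n s) = 4%N ->
  if (#|K| == 5%N) && (s %% 4 == 3)%N then
    Wset K p n s =i [:: (5 + sqrtC 5) / 2; (5 - sqrtC 5) / 2; sqrtC 5; - sqrtC 5]
  else {subset Wset K p n s <= Num.int}.
Proof.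
move=> sz4.
have memW v : v \in Wset K p n s <-> exists2 u : K, u != 0 & weil (psi p n) s u = v.
  rewrite mem_undup; split=> [/mapP[u]|[u u0 <-]].
    by rewrite mem_filter => /andP[u0 _] ->; exists u.
  by apply/mapP; exists u; rewrite // mem_filter u0 mem_enum.
have psi_0 : psi p n (0 : K) = 1 by apply: psi0.
have psi_D := psiD hp hq; have psi_nt := psi_nontrivial hp hq.
have [q5|qn5] := eqVneq #|K| 5%N; last first.
  move=> /= v /memW[u u0 <-].
  apply: (four_valued_weil_int psi_0 psi_D psi_nt hp hq hs hcop sz4) => //.
  split; first exact: undup_uniq.
    by move=> w w0; apply/memW; exists w.
  by move=> w /memW.
have p5 : p = 5%N.
  have : (5 %| p ^ n)%N by rewrite -hq q5.
  rewrite Euclid_dvdX // => /andP[+ _].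
  by rewrite dvdn_prime2 ?(pcharf_prime hp) // => /eqP.
have pch5 : 5%N \in [pchar K] by rewrite -p5.
case: (mod4_cases q5 hcop) => s4.
  (* For [s = 1] modulo 4 the power map is the identity on the field with five elements, and at most
     two values occur. *)
  have : {subset Wset K p n s <= [:: weil (psi p n) s (1 : K); 0]}.
    move=> v /memW[u _ <-]; have [->|u1] := eqVneq u 1; first by rewrite inE eqxx.
    by rewrite (weil5_deg1 psi_0 psi_D psi_nt q5 hs s4 u1) !inE eqxx orbT.
  by move/(uniq_leq_size (undup_uniq _)); rewrite [size _]sz4.
rewrite s4 /= => v; apply/idP/idP.
  by move/memW/(weil5_values psi_0 psi_D psi_nt pch5 q5 hs s4).
by move/(weil5_values psi_0 psi_D psi_nt pch5 q5 hs s4)/memW.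
Qed.
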